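(* In the standing setting described in the context, let $R$ be the global profile with sonic crossing point $\xi_s$ described in the context. Then: (a) if $0<a_s<2$, then $R\in C^{0,\beta}$ near $\xi_s$ with $\beta=\frac{1}{1+a_s/2}\in(\frac12,1)$, $R\in W^{1,r}_{\mathrm{loc}}(\mathbb R)$ for every $1\le r<1+\frac{2}{a_s}$, and $|\dot R(\xi)|\to\infty$ as $\xi\to\xi_s^\pm$; (b) if $a_s=0$, then $R\in C^{0,\beta}$ near $\xi_s$ for every $\beta<1$, $R\in W^{1,r}_{\mathrm{loc}}(\mathbb R)$ for every finite $r\ge1$, and $|\dot R(\xi)|\to\infty$ as $\xi\to\xi_s^\pm$. In particular, in both cases the density profile $R$ is not locally Lipschitz near $\xi_s$.
   Context: Standing setting. Fix $\alpha>0$, a physical equation of state $\tilde p:(0,\infty)\times\mathbb R\to\mathbb R$, $(\rho,e)\mapsto\tilde p(\rho,e)$, of class $C^2$, real numbers $c,m,q,k$ with $m\neq0$, and end states $R_\pm>0$, $U_\pm,\mathcal E_\pm\in\mathbb R$. Put $e_\pm=\mathcal E_\pm/R_\pm-\frac12U_\pm^2$ and assume the Rankine–Hugoniot relations $R_\pm(U_\pm-c)=m$, $mU_\pm+\tilde p(R_\pm,e_\pm)=q$, $(\mathcal E_\pm+\tilde p(R_\pm,e_\pm))U_\pm-c\,\mathcal E_\pm=k$. For $R>0$ define $$e(R)=e_0+\frac{A}{R}+\frac{m^2}{2R^2},\quad e_0=\frac{k-qc+\frac m2c^2}{m},\quad A=mc-q,$$ the reduced pressure $p(R)=\tilde p(R,e(R))$,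 and $\mathcal S(R)=q-mc-\frac{m^2}{R}-p(R)$. (Then $e(R_\pm)=e_\pm$ and $\mathcal S(R_\pm)=0$.) Primes denote $d/dR$, dots denote $d/d\xi$. Assume: (1) $R_-<R_+$; (2) Lax inequalities: $U_--\sqrt{p'(R_-)}>c>U_+-\sqrt{p'(R_+)}$ (with $p'(R_\pm)\ge0$); equivalently $m>0$, $\frac{m^2}{R_-^2}-p'(R_-)>0$ and $\frac{m^2}{R_+^2}-p'(R_+)<0$; (3) $p\in C^2((0,\infty))$, and one of the following convexity criteria holds along $(\rho,e)=(R,e(R))$ for $R\in[R_-,R_+]$: (A) the matrix $\begin{pmatrix}\tilde p_{\rho\rho}+\frac{m^2}{R^4}\tilde p_e&\tilde p_{\rho e}-\frac1R\tilde p_e\\ \tilde p_{\rho e}-\frac1R\tilde p_e&\tilde p_{ee}\end{pmatrix}$ is positive semidefinite; or (B) $\tilde p_{\rho\rho}\ge0$, $\tilde p_{ee}\ge0$, $\tilde p_e\ge0$, $\tilde p_{\rho e}\ge\frac1R\tilde p_e$, $e'(R)\ge0$. In particular $p''(R)\ge0$, and this inequality is assumed for all $R>0$; (4) $p''$ is Lipschitz in a neighborhood of $R_s$, where the sonic density $R_s\in(R_-,R_+)$ is the unique zero of $\mathcal S'$ in $(0,\infty)$. Sonic exponent: $a_s=-\frac{2p''(R_s)}{\mathcal S''(R_s)}$; one has $0\le a_s<2$. Canonical one-sided solutions. With $P(R)=-\frac2R-\frac{2p''(R)}{\mathcal S'(R)}$ and $Q(R)=\frac2\alpha\frac{\mathcal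 S(R)}{\mathcal S'(R)}$, $Z_-$ is the unique function in $C^1((R_-,R_s))\cap C^0([R_-,R_s))$ with $Z_-'+PZ_-=Q$ on $(R_-,R_s)$ and $Z_-(R_-)=0$; $Z_+$ is the unique function in $C^1((R_s,R_+))\cap C^0((R_s,R_+])$ with $Z_+'+PZ_+=Q$ on $(R_s,R_+)$ and $Z_+(R_+)=0$. The global profile $R:\mathbb R\to(R_-,R_+)$ (which exists, uniquely up to translation) is continuous and strictly increasing, with a point $\xi_s$ such that $R(\xi_s)=R_s$, $R$ is $C^2$ on $(-\infty,\xi_s)\cup(\xi_s,\infty)$, $\dot R^2=Z_-(R)$ on $(-\infty,\xi_s)$, $\dot R^2=Z_+(R)$ on $(\xi_s,\infty)$, $R(\xi)\to R_\pm$ and $\dot R(\xi)\to0$ as $\xi\to\pm\infty$, and for every $\varphi\in C_c^\infty(\mathbb R)$, $\int_{\mathbb R}\alpha\frac{\mathcal S'(R)}{R}\dot R\,\dot\varphi\,d\xi+\int_{\mathbb R}\big(\frac{\mathcal S(R)}{R}-2\alpha\frac{m^2}{R^4}\dot R^2\big)\varphi\,d\xi=0$. *)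

(* Defs.v *)
From HB Require Import structures.
From mathcomp Require Import all_boot all_order all_algebra.
From mathcomp Require Import all_classical all_reals all_analysis.

Set Implicit Arguments.
Unset Strict Implicit.
Unset Printing Implicit Defensive.

Import Order.TTheory GRing.Theory Num.Theory.
Import numFieldNormedType.Exports.

Local Open Scope ring_scope.
Local Open Scope classical_set_scope.

(* In ring_scope these notations denote derivatives of polynomials. *)
Local Notation "f ^` ()" := (derive1 f) : ring_scope.
Local Notation "f ^` ( n )" := (derive1n n f) : ring_scope.

(* C^k on a set D. Derivatives are two-sided, so this is the usual notion only
   for open D, which is the only case in which it is used. *)
Definition Ck (R : realType) (k : nat) (D : set R) (f : R -> R) : Prop :=
  forall x, D x ->
    (forall i : nat, (i < k)%N -> derivable f^`(i) x 1) /\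
    {for x, continuous f^`(k)}.

(* The two coordinate directions of R x R, first rho, then e. *)
Definition dir_rho (R : realType) : R * R := (1, 0).
Definition dir_e (R : realType) : R * R := (0, 1).
Arguments dir_rho {R}.
Arguments dir_e {R}.

Definition coord_dirs (R : realType) : set (R * R) := [set dir_rho; dir_e].

(* C^2 on an open subset D of the plane: all partial derivatives of order at
   most 2 exist and are continuous on D. *)
Definition C2_plane (R : realType) (D : set (R * R)) (f : R * R -> R) : Prop :=
  forall z, D z ->
    {for z, continuous f} /\
    forall v, coord_dirs v ->
      [/\ derivable f z v, {for z, continuous ('D_v f)} &
        forall w, coord_dirs w ->
          derivable ('D_v f) z w /\ {for z, continuous ('D_w ('D_v f))}].

Definition test_function (R : realType) (phi : R -> R) : Prop :=
  (forall k : nat, Ck k setT phi) /\ compact (closure [set x | phi x != 0]).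

Definition holder_near (R : realType) (b : R) (f : R -> R) (x0 : R) : Prop :=
  exists2 N : set R, nbhs x0 N &
    exists C : R, forall x y, N x -> N y ->
      `|f x - f y| <= C * `|x - y| `^ b.

Definition lipschitz_near (R : realType) (f : R -> R) (x0 : R) : Prop :=
  exists2 N : set R, nbhs x0 N & [lipschitz f x | x in N].

Definition Lr_loc (R : realType) (r : R) (f : R -> R) : Prop :=
  measurable_fun setT f /\ locally_integrable setT (fun x => `|f x| `^ r).

Definition weak_derivative (R : realType) (f g : R -> R) : Prop :=
  forall phi, test_function phi ->
    (\int[@lebesgue_measure R]_x (f x * phi^`() x)%:E =
     - \int[@lebesgue_measure R]_x (g x * phi x)%:E)%E.

(* W^{1,r}_loc(R), for real r >= 1 *)
Definition W1r_loc (R : realType) (r : R) (f : R -> R) : Prop :=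
  Lr_loc r f /\ exists2 g, Lr_loc r g & weak_derivative f g.

Definition psd (R : realType) (n : nat) (M : 'M[R]_n) : Prop :=
  M^T = M /\ forall v : 'cV[R]_n, 0 <= (v^T *m M *m v) 0 0.

(* The suffixes "minus" and "plus" stand for the two end states;
   ptilde (rho, e) is constrained, and used, for rho > 0 only. *)
Record wave_data (R : realType) := WaveData {
  alpha : R;
  ptilde : R * R -> R;
  speed : R;    (* c *)
  mflux : R;    (* m *)
  qflux : R;    (* q *)
  kflux : R;    (* k *)
  Rminus : R; Rplus : R;
  Uminus : R; Uplus : R;
  Eminus : R; Eplus : R }.

Section Wave.
Context (R : realType) (d : wave_data R).
Local Notation c := (speed d).
Local Notation m := (mflux d).
Local Notation q := (qflux d).
Local Notation k := (kflux d).

Definition eminus : R := Eminus d / Rminus d - Uminus d ^+ 2 / 2.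
Definition eplus : R := Eplus d / Rplus d - Uplus d ^+ 2 / 2.

Definition e_zero : R := (k - q * c + m / 2 * c ^+ 2) / m.
Definition Acoef : R := m * c - q.

Definition e_red (r : R) : R := e_zero + Acoef / r + m ^+ 2 / (2 * r ^+ 2).
Definition p_red (r : R) : R := ptilde d (r, e_red r).
Definition Sfun (r : R) : R := q - m * c - m ^+ 2 / r - p_red r.

Definition rankine_hugoniot (r u E e : R) : Prop :=
  [/\ r * (u - c) = m,
      m * u + ptilde d (r, e) = q &
      (E + ptilde d (r, e)) * u - c * E = k].

Record admissible_data : Prop := AdmissibleData {
  alpha_gt0 : 0 < alpha d;
  ptilde_C2 : C2_plane [set z | 0 < z.1] (ptilde d);
  mflux_neq0 : m != 0;
  Rminus_gt0 : 0 < Rminus d;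
  Rplus_gt0 : 0 < Rplus d;
  RH_minus : rankine_hugoniot (Rminus d) (Uminus d) (Eminus d) eminus;
  RH_plus : rankine_hugoniot (Rplus d) (Uplus d) (Eplus d) eplus }.

Definition lax : Prop :=
  [/\ 0 <= p_red^`() (Rminus d), 0 <= p_red^`() (Rplus d),
      Uminus d - Num.sqrt (p_red^`() (Rminus d)) > c &
      c > Uplus d - Num.sqrt (p_red^`() (Rplus d))].

Definition pt_e (r : R) : R := 'D_dir_e (ptilde d) (r, e_red r).
Definition pt_rr (r : R) : R :=
  'D_dir_rho ('D_dir_rho (ptilde d)) (r, e_red r).
Definition pt_re (r : R) : R :=
  'D_dir_e ('D_dir_rho (ptilde d)) (r, e_red r).
Definition pt_ee (r : R) : R := 'D_dir_e ('D_dir_e (ptilde d)) (r, e_red r).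

Definition convexity_matrix (r : R) : 'M[R]_2 :=
  \matrix_(i < 2, j < 2)
    if (i == 0) && (j == 0) then pt_rr r + m ^+ 2 / r ^+ 4 * pt_e r
    else if (i == 1) && (j == 1) then pt_ee r
    else pt_re r - r^-1 * pt_e r.

Definition convexA (r : R) : Prop := psd (convexity_matrix r).

Definition convexB (r : R) : Prop :=
  [/\ 0 <= pt_rr r, 0 <= pt_ee r, 0 <= pt_e r, pt_re r >= r^-1 * pt_e r &
      0 <= e_red^`() r].

Definition convexity_criterion : Prop :=
  (forall r, Rminus d <= r <= Rplus d -> convexA r) \/
  (forall r, Rminus d <= r <= Rplus d -> convexB r).

Definition sonic_density (Rs : R) : Prop :=
  [/\ Rminus d < Rs < Rplus d, Sfun^`() Rs = 0 &
      forall r, 0 < r -> Sfun^`() r = 0 -> r = Rs].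

Record standing_assumptions (Rs : R) : Prop := StandingAssumptions {
  sa_data : admissible_data;
  sa_order : Rminus d < Rplus d;
  sa_lax : lax;
  sa_p_C2 : Ck 2 [set r | 0 < r] p_red;
  sa_criterion : convexity_criterion;
  sa_convex : forall r, 0 < r -> 0 <= p_red^`(2) r;
  sa_sonic : sonic_density Rs;
  sa_p2_lipschitz : lipschitz_near p_red^`(2) Rs }.

Definition sonic_exponent (Rs : R) : R :=
  - (2 * p_red^`(2) Rs / Sfun^`(2) Rs).

Definition Pcoef (r : R) : R := - (2 / r) - 2 * p_red^`(2) r / Sfun^`() r.
Definition Qcoef (r : R) : R := 2 / alpha d * (Sfun r / Sfun^`() r).

(* The canonical one-sided solutions; Z is a total function, of which only the
   values on [R_-, R_s), resp. on (R_s, R_+], are meaningful. *)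
Definition canonical_minus (Rs : R) (Z : R -> R) : Prop :=
  [/\ Ck 1 `]Rminus d, Rs[ Z,
      {within `[Rminus d, Rs[, continuous Z},
      forall r, Rminus d < r < Rs -> Z^`() r + Pcoef r * Z r = Qcoef r &
      Z (Rminus d) = 0].

Definition canonical_plus (Rs : R) (Z : R -> R) : Prop :=
  [/\ Ck 1 `]Rs, Rplus d[ Z,
      {within `]Rs, Rplus d], continuous Z},
      forall r, Rs < r < Rplus d -> Z^`() r + Pcoef r * Z r = Qcoef r &
      Z (Rplus d) = 0].

(* The integrals are extended-real valued: the sum is 0 only if both are
   finite. The profile u need not be differentiable at the sonic crossing, where
   u^`() takes an arbitrary value; this is a null set. *)
Definition weak_profile_equation (u : R -> R) : Prop :=
  forall phi, test_function phi ->
    (\int[@lebesgue_measure R]_x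
        (alpha d * (Sfun^`() (u x) / u x) * u^`() x * phi^`() x)%:E +
     \int[@lebesgue_measure R]_x
        ((Sfun (u x) / u x
          - 2 * alpha d * (m ^+ 2 / u x ^+ 4) * u^`() x ^+ 2) * phi x)%:E
     = 0)%E.

Record global_profile (Rs : R) (Zminus Zplus : R -> R) (u : R -> R) (xs : R)
    : Prop := GlobalProfile {
  gp_range : forall x, Rminus d < u x < Rplus d;
  gp_cont : continuous u;
  gp_incr : forall x y, x < y -> u x < u y;
  gp_cross : u xs = Rs;
  gp_C2_left : Ck 2 `]-oo, xs[ u;
  gp_C2_right : Ck 2 `]xs, +oo[ u;
  gp_ode_left : forall x, x < xs -> u^`() x ^+ 2 = Zminus (u x);
  gp_ode_right : forall x, xs < x -> u^`() x ^+ 2 = Zplus (u x);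
  gp_lim_minus : u x @[x --> -oo] --> Rminus d;
  gp_lim_plus : u x @[x --> +oo] --> Rplus d;
  gp_dlim_minus : u^`() x @[x --> -oo] --> (0 : R);
  gp_dlim_plus : u^`() x @[x --> +oo] --> (0 : R);
  gp_weak : weak_profile_equation u }.

End Wave.

(* Main.v *)
(* Put r = Rs + e s with e = 1 or -1, and T = - e S'(r), which is positive and
   vanishes linearly as s -> 0+. Then w(s) = Z(r) / r^2 solves w' = - (k w + h)
   with k = 2 p''(r) / T >= 0 and h = (2 / alpha) S(r) / (r^2 T) comparable to
   1 / s. Hence w' <= - c / s, so that Z -> +oo at Rs (at least
   logarithmically), and since the Lipschitz bound on p'' gives
   k <= a_s / s + C, Gronwall's lemma yields Z <= K s^-b for every b > 0 with
   b >= a_s. As u'^2 = Z(u), the function |u - Rs|^(1 + b/2) is Lipschitz near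
   xs, which is the Hoelder bound, and |u'|^r is at most a constant times
   |u - Rs|^-g u' with g = b (r - 1) / 2 < 1, which is the derivative of a
   continuous function. One takes b = a_s if a_s > 0 and b small otherwise. *)
Require Import Defs.
From HB Require Import structures.
From mathcomp Require Import all_boot all_order all_algebra.
From mathcomp Require Import all_classical all_reals all_analysis.
From mathcomp Require Import measurable_realfun ring lra.

Set Implicit Arguments.
Unset Strict Implicit.
Unset Printing Implicit Defensive.

Import Order.TTheory GRing.Theory Num.Theory.
Import numFieldNormedType.Exports.

Local Open Scope ring_scope.
Local Open Scope classical_set_scope.

(** * Singular linear differential equations *)

(** No asymptotic expansion of [Z] is computed; two one-sided inequalities are enough. A positive
    exponent [b] is required even if a_s = 0, because the source h ~ 1/s alone already makes [w]
    grow like a logarithm, which s^-b must absorb. Since u' is unbounded at the crossing, the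
    profile is studied there through the signed powers sg(u - Rs) |u - Rs|^p, which are continuous
    everywhere for p > 0 and have derivative p |u - Rs|^(p-1) u' off [xs]. The exponent p = 1 + b/2
    makes this derivative bounded; p = 1 - g makes it, up to a constant, a majorant of |u'|^r, and g
    < 1 means r < 1 + 2/b. The sign is essential for the Hoelder bound: |u - Rs|^p alone cannot
    separate two values on opposite sides of [Rs]. *)

Lemma ge0_is_derive_le (R : realType) (f df : R -> R) (a b x y : R) :
  (forall z, a < z < b -> is_derive z 1 f (df z)) ->
  (forall z, a < z < b -> 0 <= df z) ->
  a < x -> x <= y -> y < b -> f x <= f y.
Proof.
move=> dF df0 ax xy yb.
have dF' z : z \in `[x, y]%R -> is_derive z 1 f (df z).
  rewrite in_itv/= => /andP[xz zy]; apply: dF.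
  by rewrite (lt_le_trans ax)//= (le_lt_trans zy).
have cf : {within `[x, y], continuous f}.
  by apply: derivable_within_continuous => z /dF' [].
have dF'' z : z \in `]x, y[%R -> is_derive z 1 f (df z).
  by move=> zxy; apply: dF'; apply: subset_itv_oo_cc zxy.
have [c cxy fE] := MVT_segment xy dF'' cf.
rewrite -subr_ge0 fE mulr_ge0 ?subr_ge0//; apply: df0.
by rewrite (lt_le_trans ax) ?(itvP cxy)//= (le_lt_trans _ yb)// (itvP cxy).
Qed.

Lemma is_derive_inv (R : realType) (r : R) : r != 0 ->
  is_derive r 1 (fun x : R => x^-1) (- r ^- 2).
Proof.
by move=> r0; have := is_deriveV r0 (is_derive_id r 1); rewrite scaler1.
Qed.

Lemma is_derive1_affine (R : realType) (f : R -> R) (c e s df : R) :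
  is_derive (c + e * s) 1 f df ->
  is_derive s 1 (fun t => f (c + e * t)) (e * df).
Proof.
move=> fdf.
have ids : is_derive s 1 (fun t : R => c + e * t) e.
  by apply: is_derive_eq; rewrite /GRing.scale/=; lra.
have [d E] := @is_derive1_comp R f (fun t : R => c + e * t) s df e fdf ids.
by split; [exact: d|rewrite [LHS]E mulrC].
Qed.

Section singular_linear_ode.
Context (R : realType) (s1 : R) (w k h : R -> R).
Hypothesis s1_gt0 : 0 < s1.
Hypothesis w_ode : forall s, 0 < s < s1 ->
  is_derive s 1 w (- (k s * w s + h s)).
Hypothesis w_ge0 : forall s, 0 < s < s1 -> 0 <= w s.

(* [w + c ln] is nonincreasing. *)
Lemma singular_ode_cvgy (c : R) : 0 < c ->
  (forall s, 0 < s < s1 -> 0 <= k s) ->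
  (forall s, 0 < s < s1 -> c / s <= h s) ->
  w s @[s --> 0^'+] --> +oo.
Proof.
move: (s1_gt0) => s1p c0 k0 hc.
pose G s := - (w s + c * ln s).
have G' s : 0 < s < s1 -> is_derive s 1 G ((k s * w s + h s) - c / s).
  move=> ss; have /andP[s0 _] := ss.
  have h1 := w_ode ss; have h2 := is_derive1_ln s0.
  by apply: is_derive_eq; rewrite /GRing.scale/=; lra.
have Gle s : 0 < s -> s <= s1 / 2 -> G s <= G (s1 / 2).
  move=> s0 ss; apply: (ge0_is_derive_le G') => //; last by lra.
  move=> z zz /=; have := hc _ zz; have := mulr_ge0 (k0 _ zz) (w_ge0 zz); lra.
apply/cvgryPge => A.
(* For s < exp(-b), monotonicity of [G] gives w s >= - c ln s - G (s1 / 2) > c b - G (s1 / 2) =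
   A. *)
pose b := (A + G (s1 / 2)) / c.
have cb : c * b = A + G (s1 / 2) by rewrite /b mulrC divfK// gt_eqF.
have s12 : 0 < s1 / 2 by lra.
near=> s.
have s0 : 0 < s by [].
have ss : s <= s1 / 2 by near: s; exact: nbhs_right_le.
have se : s < expR (- b) by near: s; apply: nbhs_right_lt; exact: expR_gt0.
have lnb : ln s < - b by rewrite -[ltRHS]expRK ltr_ln ?posrE ?expR_gt0.
have := Gle _ s0 ss; rewrite {1}/G.
have : c * ln s < - (c * b) by rewrite -mulrN ltr_pM2l.
rewrite cb; lra.
Unshelve. all: by end_near. Qed.

(** The integrating factor e^(C s) s^a turns the bound on [k] into monotonicity, and the extra term
    B s^a pays for the source. Thus [G] is nondecreasing, and its value at the interior point s1 / 2
    is the constant [K]. *)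
Lemma singular_ode_le_powR (a C : R) : 0 < a -> 0 <= C ->
  (forall s, 0 < s < s1 -> k s <= a / s + C) ->
  (forall s, 0 < s < s1 -> h s <= C / s) ->
  exists2 K, 0 <= K & forall s, 0 < s <= s1 / 2 -> w s <= K * s `^ (- a).
Proof.
move: (s1_gt0) => s1p a0 C0 kle hle.
(* Chosen so that (B s^a)' = C e^(C s1) s^(a-1) dominates the loss C e^(C s) s^(a-1) due to [h] on
   all of (0, s1). *)
pose B := C * expR (C * s1) / a.
pose G s := expR (C * s) * (s `^ a * w s) + B * s `^ a.
have B0 : 0 <= B by rewrite /B mulr_ge0 ?invr_ge0 ?(ltW a0)// mulr_ge0 ?expR_ge0.
pose g s := expR (C * s) * s `^ a * (w s * (C + a / s - k s) - h s)
            + B * a * (s `^ a / s).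
have G' s : 0 < s < s1 -> is_derive s 1 G (g s).
  move=> ss; have /andP[s0 _] := ss.
  have h1 := w_ode ss; have h2 := is_derive1_powR a s0.
  have h3 : is_derive s 1 (fun t : R => expR (C * t)) (C * expR (C * s)).
    have ids : is_derive s 1 (fun t : R => C * t) C.
      by apply: is_derive_eq; rewrite /GRing.scale/=; lra.
    have [d E] := @is_derive1_comp R expR (fun t : R => C * t) s _ _
      (is_derive_expR _) ids.
    by split; [exact: d|rewrite [LHS]E mulrC].
  apply: is_derive_eq; rewrite /GRing.scale/= /g.
  have sa : s `^ (a - 1) = s `^ a / s.
    by rewrite powRB ?powRr1 ?ltW// (gt_eqF s0) implybT.
  rewrite !sa; ring.
have g0 s : 0 < s < s1 -> 0 <= g s.
  move=> ss; have /andP[s0 ss1] := ss.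
  have sa0 := powR_ge0 s a; have e0 := expR_ge0 (C * s).
  have ee : expR (C * s) <= expR (C * s1) by rewrite ler_expR ler_wpM2l// ltW.
  (* The three terms are nonnegative by the bound on [k], the bound on [h] and the choice of [B],
     respectively. *)
  have -> : g s = expR (C * s) * s `^ a * (w s * (C + a / s - k s)) +
     s `^ a * (expR (C * s) * (C / s - h s))
     + (s `^ a / s) * (C * (expR (C * s1) - expR (C * s))).
    rewrite /g /B; field; apply/andP; split; exact: lt0r_neq0.
  rewrite !addr_ge0//.
  - have ws0 := w_ge0 ss; rewrite mulr_ge0// mulr_ge0//; have := kle _ ss; lra.
  - by rewrite !mulr_ge0//; have := hle _ ss; lra.
  - by rewrite !mulr_ge0 ?invr_ge0 ?subr_ge0// ltW.
exists (G (s1 / 2)).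
  have ws0 : 0 <= w (s1 / 2) by apply: w_ge0; lra.
  apply: addr_ge0; apply: mulr_ge0; rewrite ?expR_ge0 ?powR_ge0//.
  by apply: mulr_ge0; rewrite ?powR_ge0.
move=> s /andP[s0 ss].
have ss' : 0 < s < s1 by lra.
have sa0 := powR_gt0 a s0.
rewrite powRN ler_pdivlMr//.
apply: (@le_trans _ _ (G s)); last first.
  by apply: (ge0_is_derive_le G' g0) => //; lra.
have e1 : 1 <= expR (C * s) by rewrite -expR0 ler_expR mulr_ge0// ltW.
have ws0 := w_ge0 ss'.
apply: ler_wpDr; first by rewrite mulr_ge0 ?powR_ge0.
by rewrite mulrC ler_peMl// mulr_ge0// ltW.
Qed.

End singular_linear_ode.

(** * Signed powers *)

Section signed_power.
Context (R : realType).
Implicit Types (p x y : R).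

(** The odd extension of the power function; its value at 0 is 0 for every [p], since the sign of 0
    is 0. *)
Definition spowR p x : R := Num.sg x * `|x| `^ p.

Lemma is_derive_spowR p x : x != 0 ->
  is_derive x 1 (spowR p) (p * `|x| `^ (p - 1)).
Proof.
move=> x0.
(* Near [x] the sign is constant, so the absolute value is the linear map y |-> sg x * y; the
   summand 0 only gives it the affine shape of [is_derive1_affine]. *)
have sx : 0 + Num.sg x * x = `|x| by rewrite add0r -normrEsg.
have dpow : is_derive x 1 (fun y => (0 + Num.sg x * y) `^ p)
    (Num.sg x * (p * `|x| `^ (p - 1))).
  apply: (@is_derive1_affine _ (@powR R ^~ p)); rewrite sx.
  by apply: is_derive1_powR; rewrite normr_gt0.
apply: (@near_eq_is_derive _ _ _ (fun y => Num.sg x * (0 + Num.sg x * y) `^ p)).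
  have xy : \forall y \near x, Num.sg y = Num.sg x.
    have [xp|xn|/eqP] := ltgtP 0 x; last by rewrite eq_sym (negbTE x0).
      by near=> y; rewrite (gtr0_sg xp) gtr0_sg//; near: y; exact: lt_nbhsr.
    by near=> y; rewrite (ltr0_sg xn) ltr0_sg//; near: y; exact: lt_nbhsl.
  by apply: filterS xy => y xy; rewrite /spowR add0r -xy -normrEsg.
have h := dpow; apply: is_derive_eq; rewrite /GRing.scale/=.
have : Num.sg x * Num.sg x = 1 by rewrite -expr2 sqr_sg x0.
by move=> E; rewrite mulrA E mul1r.
Unshelve. all: by end_near. Qed.

Lemma continuous_spowR p : 0 < p -> continuous (spowR p).
Proof.
move=> p0 x; have [->|x0] := eqVneq x 0; last first.
  apply/differentiable_continuous/derivable1_diffP.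
  by have [] := is_derive_spowR p x0.
apply/cvgrPdist_lt => e e0; near=> y.
rewrite /spowR sgr0 mul0r sub0r normrN.
have [->|y0] := eqVneq y 0; first by rewrite sgr0 mul0r normr0.
rewrite normrM normr_sg y0 mul1r (ger0_norm (powR_ge0 _ _)).
have -> : e = (e `^ p^-1) `^ p by rewrite -powRrM mulVf ?gt_eqF// powRr1// ltW.
apply: gt0_ltr_powR => //; rewrite ?nnegrE ?powR_ge0//.
near: y; exists (e `^ p^-1); first exact: powR_gt0.
by move=> z /=; rewrite sub0r normrN.
Unshelve. all: by end_near. Qed.

Lemma continuous_norm_powR p : 0 < p -> continuous (fun x => `|x| `^ p).
Proof.
move=> p0 x.
have -> : (fun x => `|x| `^ p) = (fun x => `|spowR p x|).
  apply/funext => y; rewrite /spowR; have [->|y0] := eqVneq y 0.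
    by rewrite normr0 powR0 ?gt_eqF// mulr0 normr0.
  by rewrite normrM normr_sg y0 mul1r (ger0_norm (powR_ge0 _ _)).
by apply: continuous_comp; [exact: continuous_spowR|exact: norm_continuous].
Qed.

(** Write z^p = z z^(p-1) and expand (x + y) (x + y)^(p-1); since p - 1 >= 0, each factor (x +
    y)^(p-1) dominates x^(p-1) and y^(p-1). *)
Lemma powR_superadd p x y : 1 <= p -> 0 <= x -> 0 <= y ->
  x `^ p + y `^ p <= (x + y) `^ p.
Proof.
move=> p1 x0 y0; have p0 : 0 < p by rewrite (lt_le_trans ltr01).
have p10 : 0 <= p - 1 by rewrite subr_ge0.
rewrite -!(mulr_powRB1 _ p0)// ?addr_ge0// mulrDl lerD// ler_wpM2l//.
  by apply: ge0_ler_powR; rewrite ?nnegrE; lra.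
by apply: ge0_ler_powR; rewrite ?nnegrE; lra.
Qed.

(** The inverse of the signed power is Hoelder of exponent 1/p. For arguments of the same sign this
    is superadditivity, with constant 1; for opposite signs |x - y| is at most twice the larger
    modulus, whence 2^p. *)
Lemma distr_powR_le p x y : 1 <= p ->
  `|x - y| `^ p <= 2 `^ p * `|spowR p x - spowR p y|.
Proof.
wlog xy : x y / y <= x.
  move=> H p1; have [/H|/ltW /H] := leP y x; first exact.
  by move=> /(_ p1); rewrite distrC [in leRHS]distrC.
move=> p1; have p0 : 0 < p by rewrite (lt_le_trans ltr01).
have c1 : 1 <= 2 `^ p :> R by rewrite -[leLHS](powRr0 2) ler_powR ?ler1n// ltW.
have ps z : 0 <= z -> spowR p z = z `^ p.
  rewrite le_eqVlt => /predU1P[<-|z0].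
    by rewrite /spowR sgr0 mul0r powR0// gt_eqF.
  by rewrite /spowR gtr0_sg// mul1r gtr0_norm.
have ns z : z <= 0 -> spowR p z = - (- z) `^ p.
  rewrite le_eqVlt => /predU1P[->|z0].
    by rewrite /spowR sgr0 mul0r oppr0 powR0 ?oppr0// gt_eqF.
  by rewrite /spowR ltr0_sg// ltr0_norm// mulN1r.
rewrite [`|x - y|]ger0_norm ?subr_ge0//.
have [y0|/ltW y0] := leP 0 y.
  have x0 := le_trans y0 xy.
  have := powR_superadd p1 y0 (_ : 0 <= x - y); rewrite subr_ge0 xy => /(_ isT).
  rewrite subrKC ps// ps// => h.
  apply: (@le_trans _ _ `|x `^ p - y `^ p|); last by rewrite ler_peMl.
  by apply: le_trans (ler_norm _); lra.
have [x0|/ltW x0] := leP x 0.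
  have nx0 : 0 <= - x by rewrite oppr_ge0.
  have := powR_superadd p1 nx0 (_ : 0 <= x - y); rewrite subr_ge0 xy => /(_ isT).
  rewrite addrA addNr add0r ns// ns// => h.
  apply: (@le_trans _ _ `|- (- x) `^ p - - (- y) `^ p|); last by rewrite ler_peMl.
  by apply: le_trans (ler_norm _); lra.
rewrite ps// ns// opprK ger0_norm ?addr_ge0 ?powR_ge0//.
have ny0 : 0 <= - y by rewrite oppr_ge0.
have [xny|/ltW nyx] := leP x (- y).
  apply: (@le_trans _ _ ((2 * - y) `^ p)).
    by apply: ge0_ler_powR; rewrite ?nnegrE; lra.
  by rewrite powRM// ler_wpM2l ?powR_ge0// lerDr powR_ge0.
apply: (@le_trans _ _ ((2 * x) `^ p)).
  by apply: ge0_ler_powR; rewrite ?nnegrE; lra.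
by rewrite powRM// ler_wpM2l ?powR_ge0// lerDl powR_ge0.
Qed.

End signed_power.

(** * Integrals of derivatives and weak derivatives *)

Section derivative_integral.
Context (R : realType).
Local Notation mu := (@lebesgue_measure R).
Implicit Types (F f : R -> R) (a b : R).

(** Allows [f] to blow up at the end points. The parameterized integral [G] and [F] have the same
    derivative inside, and G - F is continuous on the closed segment, hence constant by the mean
    value theorem. *)
Lemma integrable_FTC2 F f a b : a < b -> continuous F ->
  (forall x, a < x < b -> is_derive x 1 F (f x)) ->
  (forall x, a < x < b -> {for x, continuous f}) ->
  mu.-integrable `[a, b] (EFin \o f) ->
  (\int[mu]_(x in `[a, b]) f x)%R = F b - F a.
Proof.
move=> ab cF dF cf intf.
pose G x := parameterized_integral mu a x f.
have dG x : a < x < b -> is_derive x 1 G (f x).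
  move=> /[dup] xab /andP[ax xb].
  have [d E] := continuous_FTC1_closed xb intf ax (cf _ xab).
  by split; [exact: d|rewrite -derive1E E].
have dH x : x \in `]a, b[%R -> is_derive x 1 (G - F) (f x - f x).
  by rewrite in_itv/= => xab; have := dG _ xab; have := dF _ xab => ? ?;
    apply: is_deriveB.
have cH : {within `[a, b], continuous (G - F)}.
  move=> x; apply: continuousB.
    by apply: parameterized_integral_continuous; [exact: ltW|].
  by apply: continuous_subspaceT.
have [c _] := MVT ab dH cH.
rewrite subrr mul0r => /eqP; rewrite subr_eq0 => /eqP /=.
rewrite !fctE /G {2}/parameterized_integral set_itv1 Rintegral_set1 sub0r.
by rewrite /parameterized_integral => /eqP; rewrite subr_eq addrC => /eqP.
Qed.

(** This is the source of all integrability of the slope: [f] is integrated over segments exhausting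
    the open interval, each integral is at most F b - F a because [F] is nondecreasing, and monotone
    convergence passes to the limit. *)
Lemma ge0_integral_derive_le F f a b : a < b -> continuous F ->
  (forall x, a < x < b -> is_derive x 1 F (f x)) ->
  (forall x, a < x < b -> {for x, continuous f}) ->
  (forall x, a < x < b -> 0 <= f x) ->
  (\int[mu]_(x in `]a, b[) (f x)%:E <= (F b - F a)%:E)%E.
Proof.
move=> ab cF dF cf f0.
(* Starting at 3 keeps [e n] at most a third of the length, so every [E n] is a nondegenerate
   segment. *)
pose e n : R := (b - a) / n.+3%:R.
have e0 n : 0 < e n by rewrite divr_gt0 ?subr_gt0.
have e3 n : e n <= (b - a) / 3.
  by rewrite ler_pM2l ?subr_gt0// lef_pV2 ?posrE// ler_nat.
pose E n : set R := `[a + e n, b - e n].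
have Eab n x : E n x -> a < x < b.
  by rewrite /E/= in_itv/=; have := e0 n; lra.
have abE : `]a, b[%classic = \bigcup_n E n.
  apply/seteqP; split => x /=.
    rewrite in_itv/= => xab.
    near \oo => n; exists n => //; rewrite /E/= in_itv/=.
    suff : e n <= x - a /\ e n <= b - x by lra.
    split; rewrite ler_pdivrMr// mulrC -ler_pdivrMr ?subr_gt0//; try lra.
    - near: n; exists (Num.truncn ((b - a) / (x - a))).+1 => //= n /= nn.
      rewrite ltW// (lt_le_trans (truncnS_gt _))// ler_nat.
      by rewrite (leq_trans nn)// (leq_trans (leqnSn _))// leqW.
    - near: n; exists (Num.truncn ((b - a) / (b - x))).+1 => //= n /= nn.
      rewrite ltW// (lt_le_trans (truncnS_gt _))// ler_nat.
      by rewrite (leq_trans nn)// (leq_trans (leqnSn _))// leqW.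
  by move=> [n _ /Eab]; rewrite in_itv.
have ndF x y : a <= x -> x <= y -> y <= b -> F x <= F y.
  move=> ax xy yb.
  have cw : {within `[a, b], continuous F} by exact: continuous_subspaceT.
  apply: (ger0_derive1_le_cc _ _ cw) => //; rewrite ?in_itv/=; try lra.
  - by move=> z; rewrite in_itv/= => /dF [].
  - move=> z; rewrite in_itv/= derive1E => zab.
    by have [_ ->] := dF _ zab; exact: f0.
have cfE n : {within E n, continuous f}.
  apply: continuous_in_subspaceT => x; rewrite inE => /Eab; exact: cf.
have mE n : measurable (E n : set (measurableTypeR R)) by exact: measurable_itv.
have intE n : mu.-integrable (E n) (EFin \o f).
  by apply: continuous_compact_integrable; [exact: segment_compact|exact: cfE].
have leE n : (\int[mu]_(x in E n) (f x)%:E <= (F b - F a)%:E)%E.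
  have en0 := e0 n; have en3 := e3 n.
  have abn : a + e n < b - e n by lra.
  have fin := integrable_fin_num (mE n) (intE n).
  rewrite -(fineK fin).
  rewrite lee_fin -[leLHS]/(\int[mu]_(x in E n) f x)%R.
  have -> : (\int[mu]_(x in E n) f x)%R = F (b - e n) - F (a + e n).
    apply: integrable_FTC2 => //.
    - by move=> x xE; apply: dF; lra.
    - by move=> x xE; apply: cf; lra.
    - exact: intE.
  have : F a <= F (a + e n) by apply: ndF; lra.
  have : F (b - e n) <= F b by apply: ndF; lra.
  lra.
have cv : (\int[mu]_(x in E n) (f x)%:E)%E @[n --> \oo] -->
    (\int[mu]_(x in \bigcup_n E n) (f x)%:E)%E.
  apply: (@ge0_nondecreasing_set_cvg_integral _ (measurableTypeR R) R E
    (EFin \o f) mu) => //.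
  - move=> m n mn; rewrite subsetEset; apply: subset_itv; rewrite bnd_simp.
    + by rewrite lerD2l ler_pM2l ?subr_gt0// lef_pV2 ?posrE// ler_nat.
    + by rewrite lerB// ler_pM2l ?subr_gt0// lef_pV2 ?posrE// ler_nat.
  - by move=> n; have /integrableP[] := intE n.
  - by move=> n x /Eab xab; rewrite lee_fin f0.
rewrite abE -(cvg_lim _ cv)//; apply: lime_le; last exact: nearW.
by apply/cvg_ex; eexists; apply: cv.
Unshelve. all: by end_near. Qed.
End derivative_integral.

(** * Functions that are regular off a single point *)

Section weak_derivative_off_point.
Context (R : realType).
Local Notation mu := (@lebesgue_measure R).

Lemma test_function_bounded_support (phi : R -> R) : test_function phi ->
  exists2 M, 0 < M & forall x, M <= `|x| -> phi x = 0 /\ derive1 phi x = 0.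
Proof.
move=> [_ /compact_bounded [M [_ HM]]].
have M1 : M < `|M| + 1 by rewrite (le_lt_trans (ler_norm _))// ltrDl.
exists (`|M| + 2); first by rewrite ltr_wpDl.
move=> x xM.
have Nx : (~` closure [set x | phi x != 0]) x.
  by move=> /(HM _ M1) /=; lra.
have phi0 : \forall y \near x, phi y = 0.
  have oN : open (~` closure [set x | phi x != 0]).
    by apply: closed_openC; exact: closed_closure.
  have := open_nbhs_nbhs (conj oN Nx); apply: filterS => y Ny.
  apply/eqP/negP => /negP phiy; apply: Ny; exact: subset_closure.
split; first exact: nbhs_singleton phi0.
rewrite derive1E (@near_eq_derive _ _ _ _ (cst 0)) ?derive_cst//.
Qed.

(** The fundamental theorem is applied to [u * phi] on both sides of [xs]. The boundary terms at
    [xs] cancel because [u] is continuous, so no Dirac mass appears; the outer ones vanish with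
    [phi]. *)
Lemma weak_derivative_off_point (u g : R -> R) (xs : R) : continuous u ->
  (forall x, x != xs -> is_derive x 1 u (g x)) ->
  (forall x, x != xs -> {for x, continuous g}) ->
  locally_integrable setT g -> weak_derivative u g.
Proof.
move=> cu du cg [mg _ lg] phi tphi.
have [M M0 HM] := test_function_bounded_support tphi.
have [Cphi _] := tphi.
have dphi (x : R) : is_derive x 1 phi (derive1 phi x).
  have [/(_ 0 isT) /= d _] := Cphi 1%N x I.
  by rewrite derive1E; exact: derivableP.
have cphi : continuous phi.
  move=> x; apply/differentiable_continuous/derivable1_diffP.
  by have [] := dphi x.
have cphi' : continuous (derive1 phi).
  by move=> x; have [_] := Cphi 1%N x I.
(* Large enough for [phi] and its derivative to vanish where |x| >= b, and for [xs] to lie strictly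
   inside [-b, b]. *)
pose b := M + `|xs| + 1.
have xsb : - b < xs /\ xs < b.
  by split; rewrite /b; have := ler_norm xs; have := ler_norm (- xs); rewrite normrN; lra.
have [axs xsb'] := xsb.
have bM x : b <= `|x| -> phi x = 0 /\ derive1 phi x = 0.
  by move=> bx; apply: HM; rewrite /b in bx; have := normr_ge0 xs; lra.
pose D : set (measurableTypeR R) := `[- b, b].
have mD : measurable D by exact: measurable_itv.
have cD : compact (D : set R) by exact: segment_compact.
have int1 : mu.-integrable D (EFin \o (fun x => u x * derive1 phi x)).
  apply: continuous_compact_integrable => //; apply: continuous_subspaceT => x.
  by apply: continuousM; [exact: cu|exact: cphi'].
have int2 : mu.-integrable D (EFin \o (fun x => g x * phi x)).
  have ig : mu.-integrable D (EFin \o g).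
    apply/integrableP; split; last exact: lg.
    by apply/measurable_EFinP; exact: measurable_funS mg.
  have := @integrableMl _ _ R mu D mD (EFin \o g) phi ig; apply.
    apply: measurable_funS (continuous_measurable_fun cphi) => //.
  have /compact_bounded[N [_ mrt]] := continuous_compact (continuous_subspaceT cphi) cD.
  by exists N; split; rewrite ?num_real // => ? ? ? ?; exact: mrt.
have intD := integrableD mD int1 int2.
have dF (x : R) : x != xs ->
    is_derive x 1 (u * phi) (u x * derive1 phi x + g x * phi x).
  move=> xx; have h1 := du _ xx; have h2 := dphi x.
  apply: is_derive_eq; rewrite /GRing.scale/=; lra.
have cF : continuous (u * phi).
  by move=> x; apply: continuousM; [exact: cu|exact: cphi].
pose f x := u x * derive1 phi x + g x * phi x.
have cf (x : R) : x != xs -> {for x, continuous f}.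
  move=> xx; apply: continuousD; apply: continuousM.
  - exact: cu.
  - exact: cphi'.
  - exact: cg.
  - exact: cphi.
have E0 : (\int[mu]_(x in D) f x = 0)%R.
  have DE : D = `[- b, xs]%classic `|` `]xs, b]%classic.
    by rewrite -itv_bndbnd_setU// bnd_simp ltW.
  have i1 : mu.-integrable `[- b, xs] (EFin \o f).
    by apply: integrableS intD => //; rewrite DE; exact: subsetUl.
  have i2 : mu.-integrable `]xs, b] (EFin \o f).
    by apply: integrableS intD => //; rewrite DE; exact: subsetUr.
  have i3 : mu.-integrable `[xs, b] (EFin \o f).
    by apply: integrableS intD => //; apply: subset_itv; rewrite bnd_simp// ltW.
  have -> : (\int[mu]_(x in D) f x =
      \int[mu]_(x in `[- b, xs]) f x + \int[mu]_(x in `]xs, b]) f x)%R.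
    rewrite DE Rintegral_setU//; last 2 first.
      by rewrite -DE.
    apply/disj_set2P; rewrite -subset0 => z/=; rewrite !in_itv/= => -[/andP[_]].
    by rewrite leNgt => /negbTE ->.
  rewrite Rintegral_itv_obnd_cbnd//.
  have -> : (\int[mu]_(x in `[- b, xs]) f x)%R = (u * phi) xs - (u * phi) (- b).
    apply: integrable_FTC2 => // x /andP[_ xx].
      by apply: dF; rewrite lt_eqF.
    by apply: cf; rewrite lt_eqF.
  have -> : (\int[mu]_(x in `[xs, b]) f x)%R = (u * phi) b - (u * phi) xs.
    apply: integrable_FTC2 => // x /andP[xx _].
      by apply: dF; rewrite gt_eqF.
    by apply: cf; rewrite gt_eqF.
  have [pb _] := bM b (ler_norm _).
  have [pa _] : phi (- b) = 0 /\ derive1 phi (- b) = 0.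
    by apply: bM; rewrite normrN ler_norm.
  by rewrite !fctE pa pb !mulr0; lra.
have out x : ~ D x -> phi x = 0 /\ derive1 phi x = 0.
  move=> Dx; apply: bM; rewrite leNgt; apply/negP; rewrite ltr_norml => xb.
  by apply: Dx; rewrite /D/= in_itv/=; lra.
have mkD (h : R -> R) : (forall x, ~ D x -> h x = 0) ->
    (\int[mu]_x (h x)%:E = \int[mu]_(x in D) (h x)%:E)%E.
  move=> hD; rewrite [RHS]integral_mkcond; apply: eq_integral => x _.
  rewrite patchE; case: ifPn => // /negP xD; rewrite hD// => Dx.
  by apply: xD; rewrite inE.
rewrite mkD; last by move=> x /out[_ ->]; rewrite mulr0.
rewrite mkD; last by move=> x /out[-> _]; rewrite mulr0.
have := RintegralD mD int1 int2; rewrite [X in X = _]E0 => E.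
have F1 := integrable_fin_num mD int1.
have F2 := integrable_fin_num mD int2.
rewrite -(fineK F1) -(fineK F2) -EFinN; congr (_%:E).
by apply/eqP; rewrite -addr_eq0; apply/eqP; rewrite [RHS]E.
Qed.

(** The value at [xs] is arbitrary, as it is for the slope at the crossing: the line is cut into two
    open half-lines and a singleton. *)
Lemma measurable_off_point (g : R -> R) (xs : R) :
  (forall x, x != xs -> {for x, continuous g}) -> measurable_fun setT g.
Proof.
move=> cg.
have -> : [set: R] = `]-oo, xs[%classic `|` ([set xs] `|` `]xs, +oo[%classic).
  apply/seteqP; split => // x _ /=; rewrite !in_itv/= andbT.
  by case: (ltgtP x xs); [left|right; right|right; left].
apply/measurable_funU => //; first exact: measurableU.
split; last apply/measurable_funU => //.
  apply: open_continuous_measurable_fun => // x.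
  by rewrite inE/= in_itv/= => xx; apply: cg; rewrite lt_eqF.
split; first exact: measurable_fun_set1.
apply: open_continuous_measurable_fun => // x.
by rewrite inE/= in_itv/= andbT => xx; apply: cg; rewrite gt_eqF.
Qed.

Lemma locally_integrable_off_point (h : R -> R) (xs : R) :
  measurable_fun setT h ->
  (forall M, 0 < M -> (\int[mu]_(x in `](xs - M)%R, xs[) `|h x|%:E < +oo)%E) ->
  (forall M, 0 < M -> (\int[mu]_(x in `]xs, (xs + M)%R[) `|h x|%:E < +oo)%E) ->
  locally_integrable setT h.
Proof.
move=> mh hl hr; split => //; first exact: openT.
move=> K _ cK.
have [M [_ HM]] := compact_bounded cK.
pose N := `|M| + 1 + `|xs| + 1.
have N0 : 0 < N.
  by rewrite /N; have := normr_ge0 M; have := normr_ge0 xs; lra.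
have mha (A : set (measurableTypeR R)) : measurable A ->
    measurable_fun A (fun x => (`|h x|%:E)).
  move=> mA; apply/measurable_EFinP; apply: measurableT_comp => //.
  exact: measurable_funS mh.
have KN : K `<=` `]xs - N, xs + N[.
  move=> x Kx; have := HM (`|M| + 1) _ x Kx => /=.
  have := ler_norm M; have := ler_norm x; have := ler_norm (- x).
  have := ler_norm xs; have := ler_norm (- xs); rewrite !normrN in_itv/= /N.
  move=> ? ? ? ? ? /(_ _); rewrite (le_lt_trans (ler_norm _)) ?ltrDl// => /(_ isT).
  lra.
have leN : (\int[mu]_(x in K) `|h x|%:E <=
            \int[mu]_(x in `](xs - N)%R, (xs + N)%R[) `|h x|%:E)%E.
  apply: ge0_subset_integral => //; first exact: compact_measurable.
  exact: mha.
apply: le_lt_trans leN _.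
have -> : `](xs - N), (xs + N)[%classic =
    `](xs - N), xs[%classic `|` `[xs, (xs + N)[%classic.
  by rewrite -itv_bndbnd_setU// bnd_simp; lra.
rewrite ge0_integral_setU//; last 2 first.
  apply: mha; exact: measurableU.
  apply/disj_set2P; rewrite -subset0 => z/=; rewrite !in_itv/= => -[/andP[_]].
  by rewrite ltNge => /negbTE ->.
rewrite -[X in (_ + X < _)%E]integral_itv_obnd_cbnd; last exact: mha.
by apply: lte_add_pinfty; [exact: hl|exact: hr].
Qed.

Lemma Lr_loc_continuous (f : R -> R) (r : R) : 0 < r -> continuous f ->
  Lr_loc r f.
Proof.
move=> r0 cf; split; first exact: continuous_measurable_fun.
have cfr : continuous (fun x => `|f x| `^ r).
  move=> x; apply: (@continuous_comp _ _ _ f (fun y => `|y| `^ r)).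
    exact: cf.
  exact: continuous_norm_powR.
split; [exact: continuous_measurable_fun|exact: openT|move=> K _ cK].
have : mu.-integrable K (EFin \o (fun x => `|f x| `^ r)).
  by apply: continuous_compact_integrable => //; exact: continuous_subspaceT.
by case/integrableP.
Qed.

End weak_derivative_off_point.

(** * The sonic point *)

Section sonic_point.
Context (R : realType) (d : wave_data R) (Rs : R).
Hypothesis Hsa : standing_assumptions d Rs.
(* In ring_scope these notations denote derivatives of polynomials. *)
Local Notation "f ^` ()" := (derive1 f) : ring_scope.
Local Notation "f ^` ( n )" := (derive1n n f) : ring_scope.
Local Notation m := (mflux d).
Local Notation S := (Sfun d).
Local Notation p := (p_red d).

Lemma is_derive_p_red (r : R) : 0 < r -> is_derive r 1 p (p^`() r).
Proof.
move=> r0; have [/(_ 0%N isT) dp _] := sa_p_C2 Hsa r0.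
by rewrite derive1E; exact: derivableP.
Qed.

Lemma is_derive_p_red1 (r : R) : 0 < r -> is_derive r 1 p^`() (p^`(2) r).
Proof.
move=> r0; have [/(_ 1%N isT) dp _] := sa_p_C2 Hsa r0.
rewrite derive1nS derive1E -derive1n1; exact: derivableP.
Qed.

Lemma is_derive_Sfun (r : R) : 0 < r -> is_derive r 1 S (m ^+ 2 / r ^+ 2 - p^`() r).
Proof.
move=> r0; have h1 := is_derive_p_red r0.
have r0' : r != 0 by rewrite gt_eqF.
have h2 := is_derive_inv r0'.
rewrite /Sfun; apply: is_derive_eq; rewrite /GRing.scale/=; ring.
Qed.

Lemma Sfun1E (r : R) : 0 < r -> S^`() r = m ^+ 2 / r ^+ 2 - p^`() r.
Proof. by move=> r0; rewrite derive1E; have [_ ->] := is_derive_Sfun r0. Qed.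

Lemma is_derive_Sfun1 (r : R) : 0 < r ->
  is_derive r 1 S^`() (- (2 * m ^+ 2 / r ^+ 3) - p^`(2) r).
Proof.
move=> r0; have h1 := is_derive_p_red1 r0.
have r0' : r != 0 by rewrite gt_eqF.
have h2 := is_derive_inv r0'.
apply: (@near_eq_is_derive _ R R (fun x : R => m ^+ 2 * (x^-1 * x^-1) - p^`() x)).
  near=> x; rewrite Sfun1E ?expr2 ?invfM//.
  by near: x; exact: lt_nbhsr.
apply: is_derive_eq; rewrite /GRing.scale/=; field; exact: r0'.
Unshelve. all: by end_near. Qed.

Lemma Sfun2E (r : R) : 0 < r -> S^`(2) r = - (2 * m ^+ 2 / r ^+ 3) - p^`(2) r.
Proof.
by move=> r0; rewrite derive1nS derive1E; have [_ ->] := is_derive_Sfun1 r0.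
Qed.

(** The expression is S''(r). It is strictly negative even where p'' vanishes, because m != 0; hence
    the zero of S' at [Rs] is simple. *)
Lemma Sfun2_lt0 (r : R) : 0 < r -> - (2 * m ^+ 2 / r ^+ 3) - p^`(2) r < 0.
Proof.
move=> r0; have := sa_convex Hsa r0.
have : 0 < 2 * m ^+ 2 / r ^+ 3.
  rewrite divr_gt0 ?exprn_gt0// mulr_gt0// lt0r sqrf_eq0 sqr_ge0 andbT.
  exact: mflux_neq0 (sa_data Hsa).
lra.
Qed.

Lemma sonic_gt0 : 0 < Rs.
Proof.
have [/andP[h _] _ _] := sa_sonic Hsa.
exact: lt_trans (Rminus_gt0 (sa_data Hsa)) h.
Qed.

Lemma Sfun1_MVT (x y : R) : 0 < x -> x < y -> exists2 z, x < z < y &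
  S^`() y - S^`() x = (- (2 * m ^+ 2 / z ^+ 3) - p^`(2) z) * (y - x).
Proof.
move=> x0 xy.
have dS z : z \in `[x, y]%R ->
    is_derive z 1 S^`() (- (2 * m ^+ 2 / z ^+ 3) - p^`(2) z).
  by rewrite in_itv/= => /andP[xz _]; apply: is_derive_Sfun1; exact: lt_le_trans xz.
have dS' z : z \in `]x, y[%R ->
    is_derive z 1 S^`() (- (2 * m ^+ 2 / z ^+ 3) - p^`(2) z).
  by move=> zxy; apply: dS; apply: subset_itv_oo_cc zxy.
have cS : {within `[x, y], continuous S^`()}.
  by apply: derivable_within_continuous => z /dS [].
have [z zxy ->] := MVT xy dS' cS.
by exists z => //; rewrite in_itv/= in zxy.
Qed.

Lemma Sfun1_gt0 (r : R) : 0 < r -> r < Rs -> 0 < S^`() r.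
Proof.
move=> r0 rRs; have [_ S0 _] := sa_sonic Hsa.
have [z /andP[rz zRs] E] := Sfun1_MVT r0 rRs.
have z0 := lt_trans r0 rz.
have := Sfun2_lt0 z0; rewrite S0 in E; nra.
Qed.

(** Mass conservation gives U_- = c + m / R_-; eliminating [k] and [q] by the other two relations
    yields e(R_-) = e_-, and momentum conservation becomes the claim. *)
Lemma Sfun_Rminus : S (Rminus d) = 0.
Proof.
have D := sa_data Hsa; have r0 := Rminus_gt0 D.
have [h1 h2 h3] := RH_minus D; have m0 := mflux_neq0 D.
have rn0 : Rminus d != 0 by rewrite gt_eqF.
have UE : Uminus d = speed d + m / Rminus d.
  by rewrite -h1; field.
have eE : e_red d (Rminus d) = eminus d.
  rewrite /e_red /e_zero /Acoef /eminus -h3 -h2 UE.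
  field; do ?[apply/andP; split]; assumption.
rewrite /Sfun /p_red eE -h2 UE; field; exact: rn0.
Qed.

(** [S] starts from 0 at R_- and has positive derivative up to [Rs]. This positivity makes the
    source a genuine 1/s singularity. *)
Lemma Sfun_sonic_gt0 : 0 < S Rs.
Proof.
have [/andP[h _] _ _] := sa_sonic Hsa; have r0 := Rminus_gt0 (sa_data Hsa).
have dS z : z \in `[Rminus d, Rs]%R -> is_derive z 1 S (S^`() z).
  rewrite in_itv/= => /andP[xz _]; have z0 := lt_le_trans r0 xz.
  by rewrite (Sfun1E z0); exact: is_derive_Sfun.
have dS' z : z \in `]Rminus d, Rs[%R -> is_derive z 1 S (S^`() z).
  by move=> zxy; apply: dS; apply: subset_itv_oo_cc zxy.
have cS : {within `[Rminus d, Rs], continuous S}.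
  by apply: derivable_within_continuous => z /dS [].
have [z + E] := MVT h dS' cS; rewrite in_itv/= => /andP[z1 z2].
rewrite Sfun_Rminus subr0 in E; rewrite E mulr_gt0 ?subr_gt0//.
by apply: Sfun1_gt0 => //; exact: lt_trans z1.
Qed.

End sonic_point.

(** * Quantitative bounds near the sonic density *)

Lemma is_derive_lipschitz_at (R : realType) (f : R -> R) (x0 df : R) :
  is_derive x0 1 f df ->
  exists2 K, 0 <= K & \forall x \near x0, `|f x - f x0| <= K * `|x - x0|.
Proof.
move=> /is_derive1_caratheodory[g [gE cg g0]].
exists (`|df| + 1); first by rewrite addr_ge0.
near=> x; rewrite gE normrM ler_wpM2r//.
rewrite -g0; near: x; apply: (@cvgr_norm_le _ _ _ _ _ g (g x0)); first exact: cg.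
by rewrite ltrDl.
Unshelve. all: by end_near. Qed.

(** Here D0 = - S''(Rs), P0 = p''(Rs), and a D0 = 2 P0 defines the sonic exponent. The constant C
    solves C D0 / 2 = 2 K + a K: as D0 - K s >= D0 / 2, this gives (a + C s) (D0 - K s) >= a D0 + 2
    K s >= 2 P. *)
Lemma singular_coef_le (R : realType) (a D0 K P P0 s T : R) :
  0 < D0 -> 0 <= K -> 0 <= a -> 0 < s -> a * D0 = 2 * P0 -> P <= P0 + K * s ->
  K * s <= D0 / 2 -> (D0 - K * s) * s <= T ->
  2 * P / T <= a / s + (4 * K + 2 * a * K) / D0.
Proof.
move=> D00 K0 a0 s0 aD PP KsD T1.
pose C := (4 * K + 2 * a * K) / D0.
have C0 : 0 <= C by rewrite divr_ge0 ?(ltW D00)// addr_ge0// !mulr_ge0.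
have DK : 0 < D0 - K * s by lra.
have T0 : 0 < T by apply: lt_le_trans T1; exact: mulr_gt0.
have E : a / s + C = (a + C * s) / s by rewrite mulrDl mulfK// gt_eqF.
rewrite -/C ler_pdivrMr// E mulrAC ler_pdivlMr//.
have CD : C * (D0 / 2) = 2 * K + a * K by rewrite /C; field; rewrite gt_eqF.
have h1 : (a + C * s) * ((D0 - K * s) * s) <= (a + C * s) * T.
  by rewrite ler_wpM2l// addr_ge0// mulr_ge0// ltW.
apply: le_trans h1; rewrite mulrA ler_wpM2r//; first exact: ltW.
have h3 : (2 * K + a * K) * s <= C * s * (D0 - K * s).
  rewrite -CD [leLHS]mulrAC; apply: ler_wpM2l; last by lra.
  by rewrite mulr_ge0// ltW.
rewrite [leRHS]mulrDl [a * _]mulrBr aD; lra.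
Qed.

(** Used with B = 2 / alpha, S0 = S(Rs), r0 = Rs and D0 = - S''(Rs): every factor of the source
    stays within a factor 2 of its sonic value, except [T], which is comparable to s. *)
Lemma singular_source_bounds (R : realType) (B S0 Sr r r0 D0 s T : R) :
  0 < B -> 0 < S0 -> 0 < D0 -> 0 < r0 -> 0 < s ->
  S0 / 2 <= Sr <= 2 * S0 -> r0 / 2 <= r <= 2 * r0 ->
  D0 / 2 * s <= T <= 2 * D0 * s ->
  (B * (S0 / 2)) / ((2 * r0) ^+ 2 * (2 * D0)) / s <= B * Sr / (r ^+ 2 * T)
  <= (B * (2 * S0)) / ((r0 / 2) ^+ 2 * (D0 / 2)) / s.
Proof.
move=> B0 S00 D00 r00 s0 /andP[S1 S2] /andP[r1 r2] /andP[T1 T2].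
have S10 : 0 < S0 / 2 by lra.
have r10 : 0 < r0 / 2 by lra.
have D10 : 0 < D0 / 2 by lra.
have rp : 0 < r by exact: lt_le_trans r1.
have T0 : 0 < T by apply: lt_le_trans T1; exact: mulr_gt0.
have Sp : 0 < Sr by exact: lt_le_trans S1.
have q0 : 0 < r ^+ 2 * T by rewrite mulr_gt0 ?exprn_gt0.
have assoc (x y z : R) : x / (y * z) / s = x / (y * (z * s)).
  by rewrite -[LHS]mulrA -invfM -[y * z * s]mulrA.
have pos0 (x y : R) : 0 < x -> 0 < y -> 0 < x ^+ 2 * y.
  by move=> x0 y0; rewrite mulr_gt0 ?exprn_gt0.
rewrite !assoc; apply/andP; split; apply: ler_pM.
- by rewrite mulr_ge0// ltW.
- by rewrite invr_ge0 ltW// pos0 ?mulr_gt0.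
- by rewrite ler_wpM2l// ltW.
- rewrite lef_pV2 ?posrE ?pos0 ?mulr_gt0//.
  apply: ler_pM => //; [exact: sqr_ge0|exact: ltW|].
  by rewrite ler_sqr ?nnegrE ?mulr_ge0 ?(ltW rp) ?(ltW r00).
- by rewrite mulr_ge0// ltW.
- by rewrite invr_ge0 ltW.
- by rewrite ler_wpM2l// ltW.
- rewrite lef_pV2 ?posrE ?pos0 ?mulr_gt0//.
  apply: ler_pM => //; [exact: sqr_ge0|by rewrite mulr_ge0// ltW|].
  by rewrite ler_sqr ?nnegrE// ltW.
Qed.

Section sonic_estimates.
Context (R : realType) (d : wave_data R) (Rs : R).
Hypothesis Hsa : standing_assumptions d Rs.
Local Notation "f ^` ()" := (derive1 f) : ring_scope.
Local Notation "f ^` ( n )" := (derive1n n f) : ring_scope.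
Local Notation m := (mflux d).
Local Notation S := (Sfun d).
Local Notation p := (p_red d).
Local Notation a := (sonic_exponent d Rs).
Local Notation D := (fun z => 2 * m ^+ 2 / z ^+ 3 + p^`(2) z).

(** Here [D] is - S''. The Lipschitz hypothesis on p'' enters at this point: it makes the error in k
    <= a_s / s + C bounded, so that an exponential factor can absorb it. *)
Lemma Sfun2_lipschitz_at : exists2 K, 0 <= K &
  \forall z \near Rs, `|D z - D Rs| <= K * `|z - Rs| /\
                      `|p^`(2) z - p^`(2) Rs| <= K * `|z - Rs|.
Proof.
have Rs0 := sonic_gt0 Hsa; have Rsn0 : Rs != 0 by rewrite gt_eqF.
have [N NRs [M [_ HM]]] := sa_p2_lipschitz Hsa.
have NRs' := nbhs_singleton NRs.
have p2L : \forall z \near Rs,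
    `|p^`(2) z - p^`(2) Rs| <= (`|M| + 1) * `|z - Rs|.
  apply: filterS NRs => z Nz.
  have := HM (`|M| + 1); rewrite (le_lt_trans (ler_norm _)) ?ltrDl// => /(_ isT).
  by move=> /(_ (z, Rs)) /=; apply; split.
have [K K0 HK] : exists2 K, 0 <= K & \forall z \near Rs,
    `|2 * m ^+ 2 / z ^+ 3 - 2 * m ^+ 2 / Rs ^+ 3| <= K * `|z - Rs|.
  have h2 := is_derive_inv Rsn0.
  have E : (fun z => 2 * m ^+ 2 / z ^+ 3) =
      (fun z : R => 2 * m ^+ 2 * (z^-1 * (z^-1 * z^-1))).
    by apply/funext => t; congr (_ * _); rewrite !exprS expr0 mulr1 !invfM.
  have h3 : derivable (fun z : R => 2 * m ^+ 2 / z ^+ 3) Rs 1.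
    by rewrite E; exact: ex_derive.
  exact: is_derive_lipschitz_at (derivableP h3).
exists (`|M| + 1 + K); first by rewrite !addr_ge0.
near=> z.
have h1 : `|p^`(2) z - p^`(2) Rs| <= (`|M| + 1) * `|z - Rs| by near: z.
have h2 : `|2 * m ^+ 2 / z ^+ 3 - 2 * m ^+ 2 / Rs ^+ 3| <= K * `|z - Rs|.
  by near: z.
split; last by have := normr_ge0 (z - Rs); nra.
have sumB (x y x' y' : R) : (x + y) - (x' + y') = (y - y') + (x - x') by ring.
rewrite sumB [leRHS]mulrDl; apply: (le_trans (ler_normD _ _)).
exact: lerD.
Unshelve. all: by end_near. Qed.

Lemma Sfun1_sonic_MVT (e s : R) : e = 1 \/ e = -1 -> 0 < s -> 0 < Rs + e * s ->
  exists2 z, `|z - Rs| < s & - e * S^`() (Rs + e * s) = D z * s.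
Proof.
have Rs0 := sonic_gt0 Hsa; have [_ S0 _] := sa_sonic Hsa.
move=> [->|->] s0 r0.
- have [|z zs E] := @Sfun1_MVT _ _ _ Hsa Rs (Rs + 1 * s) Rs0; first lra.
  exists z; first by rewrite ltr_norml; lra.
  by rewrite S0 subr0 in E; rewrite E addrAC subrr add0r mul1r mulN1r -mulNr opprD !opprK.
- have [|z zs E] := @Sfun1_MVT _ _ _ Hsa (Rs + -1 * s) Rs r0; first lra.
  exists z; first by rewrite ltr_norml; lra.
  rewrite S0 in E; rewrite /= opprK mul1r; rewrite sub0r in E.
  by rewrite -[LHS]opprK E opprD mulN1r opprK addrA subrr add0r -mulNr opprD !opprK.
Qed.

Lemma curvature_sonic_gt0 : 0 < D Rs.
Proof.
have := Sfun2_lt0 Hsa (sonic_gt0 Hsa).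
by rewrite -opprD oppr_lt0.
Qed.

Lemma sonic_exponentE : a * D Rs = 2 * p^`(2) Rs.
Proof.
have D0 := curvature_sonic_gt0.
have -> : a = - (2 * p^`(2) Rs / - D Rs).
  by rewrite /sonic_exponent (Sfun2E Hsa (sonic_gt0 Hsa)) /= opprD.
by rewrite invrN mulrN opprK divfK// gt_eqF.
Qed.

Lemma sonic_exponent_ge0 : 0 <= a.
Proof.
have D0 := curvature_sonic_gt0.
rewrite -(pmulr_lge0 _ D0) sonic_exponentE mulr_ge0//.
exact: sa_convex Hsa _ (sonic_gt0 Hsa).
Qed.

Lemma sonic_estimates : exists s1 c C, [/\ 0 < s1, 0 < c, 0 <= C &
  forall e s, e = 1 \/ e = -1 -> 0 < s < s1 ->
  let r := Rs + e * s in let T := - e * S^`() r in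
  [/\ Rminus d < r < Rplus d, 0 < T, 2 * p^`(2) r / T <= a / s + C,
      c / s <= 2 / alpha d * S r / (r ^+ 2 * T) &
      2 / alpha d * S r / (r ^+ 2 * T) <= C / s]].
Proof.
have Rs0 := sonic_gt0 Hsa; have [/andP[RmRs RsRp] _ _] := sa_sonic Hsa.
have [D0 D00 D0E] : exists2 D0, 0 < D0 & D0 = D Rs.
  by exists (D Rs) => //; exact: curvature_sonic_gt0.
have aD : a * D0 = 2 * p^`(2) Rs by rewrite D0E sonic_exponentE.
have [K K0 HK] := Sfun2_lipschitz_at.
have S0 := Sfun_sonic_gt0 Hsa; have a0 := sonic_exponent_ge0.
have B0 : 0 < 2 / alpha d by rewrite divr_gt0// (alpha_gt0 (sa_data Hsa)).
have cS : {for Rs, continuous S}.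
  have [dS _] := is_derive_Sfun Hsa Rs0.
  by apply: differentiable_continuous; exact/derivable1_diffP.
have S0' : 0 < S Rs / 2 by rewrite divr_gt0.
have nS : \forall r \near Rs, S Rs / 2 <= S r <= 2 * S Rs.
  move/cvgrPdist_le : cS => /(_ _ S0'); apply: filterS => r.
  by clear; rewrite ler_norml; lra.
have [dl dl0 Hdl] : exists2 dl : R, 0 < dl & forall z, `|z - Rs| < dl ->
   (`|D z - D Rs| <= K * `|z - Rs| /\
    `|p^`(2) z - p^`(2) Rs| <= K * `|z - Rs|) /\ S Rs / 2 <= S z <= 2 * S Rs.
  have := filterI HK nS; rewrite -nbhs_ballE => -[dl dl0 H].
  by exists dl => // z zs; apply: H; rewrite /ball/= distrC.
have K1 : 0 < 2 * (K + 1) by rewrite mulr_gt0// ltr_wpDl.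
have Rs2 : 0 < Rs / 2 by rewrite divr_gt0.
have D2 : 0 < D0 / 2 by rewrite divr_gt0.
pose C0 := (4 * K + 2 * a * K) / D0.
pose C1 := (2 / alpha d * (2 * S Rs)) / ((Rs / 2) ^+ 2 * (D0 / 2)).
have C00 : 0 <= C0 by rewrite divr_ge0 ?(ltW D00)// addr_ge0// !mulr_ge0.
have C10 : 0 <= C1.
  apply: divr_ge0; first by rewrite mulr_ge0 ?(ltW B0)// mulr_ge0// ltW.
  by rewrite mulr_ge0 ?sqr_ge0 ?(ltW D2).
(* The bounds on s ensure, in order: the local estimates, r comparable to [Rs], r between the end
   states (two bounds), and K s <= D0 / 2, where K + 1 replaces K to allow K = 0. *)
exists (Num.min dl (Num.min (Rs / 2) (Num.min (Rs - Rminus d)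
  (Num.min (Rplus d - Rs) (D0 / (2 * (K + 1))))))).
exists ((2 / alpha d * (S Rs / 2)) / ((2 * Rs) ^+ 2 * (2 * D0))), (C0 + C1).
split.
- by rewrite !lt_min dl0 Rs2 !subr_gt0 RmRs RsRp divr_gt0.
- apply: divr_gt0; first exact: mulr_gt0.
  by rewrite mulr_gt0 ?mulr_gt0// exprn_gt0// mulr_gt0.
- exact: addr_ge0.
move=> e s e1 ss r T; move: ss => /andP[s0].
rewrite !lt_min => /and5P[sdl sRs sRm sRp sD].
have rRs : `|r - Rs| = s.
  rewrite /r addrAC subrr add0r normrM (gtr0_norm s0).
  by case: e1 => ->; rewrite ?normrN normr1 mul1r.
have rs : Rs - s <= r <= Rs + s.
  by move: rRs; clearbody r; clear -s0; move/eqP; rewrite eqr_norml; lra.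
have KsD : K * s <= D0 / 2.
  by move: sD; rewrite ltr_pdivlMr//; clear -s0 K0; nra.
have r0 : 0 < r by clear -rs sRs Rs0; lra.
have [z zs TE] := Sfun1_sonic_MVT e1 s0 r0.
rewrite -/r -/T in TE.
have [[Dz _] _] := Hdl z (lt_trans zs sdl).
have rdl : `|r - Rs| < dl by rewrite rRs.
have [[_ pr] Sr] := Hdl r rdl.
rewrite rRs in pr.
have : `|D z - D Rs| <= K * s.
  by apply: (le_trans Dz); rewrite ler_wpM2l// ltW.
move: Dz TE; rewrite -D0E; set Dzz := D z => Dz TE.
rewrite ler_norml => /andP[Dz1 Dz2].
have T1 : (D0 - K * s) * s <= T.
  by rewrite TE ler_wpM2r ?(ltW s0)//; clear -Dz1; lra.
have T2 : D0 / 2 * s <= T.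
  by rewrite TE ler_wpM2r ?(ltW s0)//; clear -Dz1 KsD; lra.
have T3 : T <= 2 * D0 * s.
  by rewrite TE ler_wpM2r ?(ltW s0)//; clear -Dz2 KsD D00; lra.
have T0 : 0 < T by apply: lt_le_trans T2; exact: mulr_gt0.
have pr' : p^`(2) r <= p^`(2) Rs + K * s.
  by move: pr; rewrite ler_norml => /andP[_]; rewrite lerBlDr addrC.
have T23 : D0 / 2 * s <= T <= 2 * D0 * s by rewrite T2.
have rRs2 : Rs / 2 <= r <= 2 * Rs by clear -rs sRs Rs0; lra.
have /andP[h1 h2] := singular_source_bounds B0 S0 D00 Rs0 s0 Sr rRs2 T23.
split => //.
- by clear -rs sRm sRp; lra.
- apply: (le_trans (singular_coef_le D00 K0 a0 s0 aD pr' KsD T1)).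
  by rewrite lerD2l lerDl.
- apply: (le_trans h2); rewrite -/C1.
  by rewrite ler_pM2r ?invr_gt0// lerDr.
Qed.

End sonic_estimates.

(** * The one-sided solutions at the sonic point *)

Section one_sided_solution.
Context (R : realType) (d : wave_data R) (Rs : R).
Hypothesis Hsa : standing_assumptions d Rs.
Local Notation "f ^` ()" := (derive1 f) : ring_scope.
Local Notation "f ^` ( n )" := (derive1n n f) : ring_scope.
Local Notation S := (Sfun d).
Local Notation p := (p_red d).
Local Notation a := (sonic_exponent d Rs).
Context (e s0 : R) (Z : R -> R).
Hypothesis e1 : e = 1 \/ e = -1.
Hypothesis s0_gt0 : 0 < s0.
Hypothesis Z_ode : forall s, 0 < s < s0 -> let r := Rs + e * s in
  is_derive r 1 Z (Qcoef d r - Pcoef d r * Z r).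
Hypothesis Z_ge0 : forall s, 0 < s < s0 -> 0 <= Z (Rs + e * s).

Let w s := Z (Rs + e * s) / (Rs + e * s) ^+ 2.
Let k s := 2 * p^`(2) (Rs + e * s) / (- e * S^`() (Rs + e * s)).
Let h s := 2 / alpha d * S (Rs + e * s) /
  ((Rs + e * s) ^+ 2 * (- e * S^`() (Rs + e * s))).

(* Dividing by [r ^+ 2] absorbs the regular part [- 2 / r] of [Pcoef]. *)
Lemma scaled_solution_ode s : 0 < s < s0 -> 0 < Rs + e * s ->
  S^`() (Rs + e * s) != 0 -> is_derive s 1 w (- (k s * w s + h s)).
Proof.
move=> ss r0 S1; have r0' : Rs + e * s != 0 by rewrite gt_eqF.
have hZ : is_derive (Rs + e * s) 1 Z _ := Z_ode ss.
have h2 := is_derive_inv r0'.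
have al0 : alpha d != 0 by rewrite gt_eqF// (alpha_gt0 (sa_data Hsa)).
have wE : w = (fun s => (fun x => Z x * (x^-1 * x^-1)) (Rs + e * s)).
  by apply/funext => t; rewrite /w expr2 invfM.
rewrite wE.
pose dV := (Qcoef d (Rs + e * s) - Pcoef d (Rs + e * s) * Z (Rs + e * s))
           / (Rs + e * s) ^+ 2 - 2 * Z (Rs + e * s) / (Rs + e * s) ^+ 3.
have hV : is_derive (Rs + e * s) 1 (fun x => Z x * (x^-1 * x^-1)) dV.
  apply: is_derive_eq; rewrite /GRing.scale/= /dV.
  by move: (Qcoef d _) (Pcoef d _) (Z _) => q1 p1 z1; field.
apply: (is_derive_eq (is_derive1_affine hV)).
rewrite /dV /k /h /Pcoef /Qcoef.
move: S1 r0' al0; set r := Rs + e * s.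
move: (S^`() r) (S r) (p^`(2) r) (Z r) (alpha d) => S1 S0 p2 z al S1n r0' al0.
by move: (r) r0' => r' r0'; case: e1 => ->; field; rewrite ?S1n ?r0' ?al0.
Qed.

Lemma scaled_solution_estimates : exists s3 c C, [/\ 0 < s3, 0 < c, 0 <= C &
  forall s, 0 < s < s3 -> [/\ Rminus d < Rs + e * s < Rplus d,
    is_derive s 1 w (- (k s * w s + h s)), 0 <= w s,
    0 <= k s <= a / s + C & c / s <= h s <= C / s]].
Proof.
have [s1 [c [C [s10 c0 C0 est]]]] := sonic_estimates Hsa.
have Rm0 := Rminus_gt0 (sa_data Hsa).
exists (Num.min s0 s1), c, C; split => //; first by rewrite lt_min s0_gt0.
move=> s; rewrite lt_min => /and3P[s'0 ss0 ss1].
have s'1 : 0 < s < s1 by rewrite s'0.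
have s'2 : 0 < s < s0 by rewrite s'0.
have [r1 T0 k1 h1 h2] := est e s e1 s'1.
have r0 : 0 < Rs + e * s by case/andP: r1 => r1 _; exact: lt_trans r1.
split => //.
- apply: scaled_solution_ode => //.
  by apply: contraTneq T0 => ->; rewrite mulr0 ltxx.
- by rewrite divr_ge0 ?Z_ge0// sqr_ge0.
- rewrite k1 andbT divr_ge0 ?(ltW T0)// mulr_ge0//.
  exact: (sa_convex Hsa).
- by rewrite h1.
Qed.

Lemma one_sided_solutionE s : Rminus d < Rs + e * s ->
  Z (Rs + e * s) = (Rs + e * s) ^+ 2 * w s.
Proof.
move=> r1; rewrite /w mulrCA divff ?mulr1// sqrf_eq0 gt_eqF//.
exact: lt_trans (Rminus_gt0 (sa_data Hsa)) r1.
Qed.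

Lemma one_sided_solution_cvgy : Z (Rs + e * s) @[s --> 0^'+] --> +oo.
Proof.
have [s3 [c [C [s30 c0 C0 est]]]] := scaled_solution_estimates.
have Rm0 := Rminus_gt0 (sa_data Hsa).
have wy : w s @[s --> 0^'+] --> +oo.
  apply: (@singular_ode_cvgy _ s3 w k h s30 _ _ c) => // s /est.
  - by case.
  - by case.
  - by case=> _ _ _ /andP[].
  - by case=> _ _ _ _ /andP[].
apply/cvgryPge => A; near=> s.
have ss : 0 < s < s3 by rewrite andbC; apply/andP; split.
have [/andP[r1 _] _ w0 _ _] := est s ss.
rewrite one_sided_solutionE//.
have wA : A / Rminus d ^+ 2 <= w s.
  by near: s; move/cvgryPge : wy; exact.
move: wA; rewrite ler_pdivrMr ?exprn_gt0// => /le_trans; apply.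
rewrite mulrC ler_wpM2r// ler_sqr ?nnegrE ltW//.
exact: lt_trans r1.
Unshelve. all: by end_near. Qed.

(** Since a / s <= b / s, the coefficient bound holds with the positive exponent [b] even if a_s =
    0; returning from [w] to [Z] costs the factor R_+^2. *)
Lemma one_sided_solution_le (b : R) : 0 < b -> a <= b ->
  exists K s2, [/\ 0 <= K, 0 < s2 &
    forall s, 0 < s <= s2 -> Z (Rs + e * s) <= K * s `^ (- b)].
Proof.
have [s3 [c [C [s30 c0 C0 est]]]] := scaled_solution_estimates.
move=> b0 ab; have Rp0 := Rplus_gt0 (sa_data Hsa).
have [K K0 HK] : exists2 K, 0 <= K &
    forall s, 0 < s <= s3 / 2 -> w s <= K * s `^ (- b).
  apply: (@singular_ode_le_powR _ s3 w k h s30 _ _ b C) => // s.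
  - by move=> /est[].
  - by move=> /est[].
  - move=> /[dup] /andP[s'0 _] /est[_ _ _ /andP[_ h1] _].
    by apply: (le_trans h1); rewrite lerD2r ler_pM2r ?invr_gt0.
  - by move=> /est[_ _ _ _ /andP[]].
exists (Rplus d ^+ 2 * K), (s3 / 2); split.
- by rewrite mulr_ge0// sqr_ge0.
- by rewrite divr_gt0.
move=> s /[dup] s2 /andP[s'0 s'2].
have s'3 : 0 < s < s3.
  by rewrite s'0 (le_lt_trans s'2)// ltr_pdivrMr// ltr_pMr// ltr1n.
have [/andP[r1 r2] _ w0 _ _] := est _ s'3.
rewrite one_sided_solutionE// -[leRHS]mulrA.
have r0 := lt_trans (Rminus_gt0 (sa_data Hsa)) r1.
apply: ler_pM => //; [exact: sqr_ge0| |exact: HK].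
by rewrite ler_sqr ?nnegrE ltW.
Qed.

End one_sided_solution.

(** * The profile *)

(** The mean value theorem handles pairs on one side of [xs]; a pair straddling [xs] is split there,
    and the two lengths add up with the same constant [L]. *)
Lemma lipschitz_off_point (R : realType) (F f : R -> R) (xs L M : R) :
  continuous F -> (forall x, x != xs -> is_derive x 1 F (f x)) ->
  (forall x, x != xs -> `|x - xs| <= M -> `|f x| <= L) ->
  forall x y, `|x - xs| <= M -> `|y - xs| <= M -> `|F x - F y| <= L * `|x - y|.
Proof.
move=> cF dF fL.
have H x y : x < y -> `|x - xs| <= M -> `|y - xs| <= M -> xs <= x \/ y <= xs ->
    `|F y - F x| <= L * (y - x).
  move=> xy xM yM xyx.
  have cw : {within `[x, y], continuous F} by exact: continuous_subspaceT.
  have ne z : z \in `]x, y[%R -> z != xs.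
    rewrite in_itv/= => /andP[xz zy]; case: xyx => h.
      by rewrite gt_eqF// (le_lt_trans h).
    by rewrite lt_eqF// (lt_le_trans zy).
  have [z /[dup] /ne zxs + ->] := MVT xy (fun z zxy => dF z (ne z zxy)) cw.
  rewrite in_itv/= => /andP[xz zy].
  rewrite normrM [X in _ * X]gtr0_norm ?subr_gt0// ler_wpM2r ?subr_ge0 ?(ltW xy)//.
  by apply: fL => //; move: xM yM; rewrite !ler_norml; clear -xz zy; lra.
have H' x y : x < y -> `|x - xs| <= M -> `|y - xs| <= M ->
    `|F y - F x| <= L * (y - x).
  move=> xy xM yM; have [h|h] := leP xs x; first by apply: H => //; left.
  have [h'|h'] := leP y xs; first by apply: H => //; right.
  have M0 : `|xs - xs| <= M by rewrite subrr normr0 (le_trans _ xM).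
  have -> : L * (y - x) = L * (y - xs) + L * (xs - x) by ring.
  have -> : F y - F x = (F y - F xs) + (F xs - F x) by ring.
  apply: (le_trans (ler_normD _ _)); apply: lerD; apply: H => //.
    by left.
  by right.
move=> x y xM yM; have [xy|yx|->] := ltgtP x y.
- by rewrite distrC [`|x - y|]distrC [X in L * X]gtr0_norm ?subr_gt0// H'.
- by rewrite [X in L * X]gtr0_norm ?subr_gt0// H'.
- by rewrite !subrr normr0 mulr0.
Qed.

(** * The profile on one side of the crossing *)

Section profile_side.
Context (R : realType) (d : wave_data R) (Rs : R).
Hypothesis Hsa : standing_assumptions d Rs.
Local Notation "f ^` ()" := (derive1 f) : ring_scope.
Local Notation a := (sonic_exponent d Rs).
Context (e s0 xs : R) (Z u : R -> R).
Hypothesis e1 : e = 1 \/ e = -1.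
Hypothesis s0_gt0 : 0 < s0.
Hypothesis Z_ode : forall s, 0 < s < s0 -> let r := Rs + e * s in
  is_derive r 1 Z (Qcoef d r - Pcoef d r * Z r).
Hypothesis u_cont : continuous u.
Hypothesis u_xs : u xs = Rs.
Hypothesis u_range : forall x, Rminus d < u x < Rplus d.
Hypothesis u_side : forall t, 0 < t -> 0 < e * (u (xs + e * t) - Rs).
Hypothesis u_ode : forall t, 0 < t ->
  u^`() (xs + e * t) ^+ 2 = Z (u (xs + e * t)).
Hypothesis du_cont : forall t, 0 < t -> {for xs + e * t, continuous u^`()}.

(** The distance from u to [Rs] in terms of the distance t to [xs]; the factors [e] fold either side
    onto t > 0 and v t > 0. *)
Let v t := e * (u (xs + e * t) - Rs).

Let ee : e * e = 1.
Proof. by case: e1 => ->; rewrite ?mulrNN mulr1. Qed.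

Let uE t : u (xs + e * t) = Rs + e * v t.
Proof. by rewrite /v mulrA ee mul1r subrKC. Qed.

Let v_cont : continuous v.
Proof.
move=> t; rewrite /continuous_at /v; apply: cvgM; first exact: cvg_cst.
apply: cvgB; last exact: cvg_cst.
apply: (@continuous_comp _ _ _ (fun t => xs + e * t) u); last exact: u_cont.
apply: cvgD; first exact: cvg_cst.
by apply: cvgM; [exact: cvg_cst|exact: cvg_id].
Qed.

Let v0 : v 0 = 0.
Proof. by rewrite /v mulr0 addr0 u_xs subrr mulr0. Qed.

Let vE t : `|u (xs + e * t) - Rs| = `|v t|.
Proof.
rewrite /v normrM; suff -> : `|e| = 1 by rewrite mul1r.
by case: e1 => ->; rewrite ?normrN normr1.
Qed.

Let v_small (s1 : R) : 0 < s1 ->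
  exists2 t1, 0 < t1 & forall t, 0 < t < t1 -> 0 < v t < s1.
Proof.
move=> s10; move/cvgrPdist_lt : (v_cont (x := 0)) => /(_ _ s10).
rewrite -nbhs_ballE => -[t1 t10 H]; exists t1 => // t /andP[t0 tt1].
have /= := H t; rewrite /ball/= sub0r normrN gtr0_norm// => /(_ tt1).
by rewrite v0 sub0r normrN gtr0_norm ?u_side.
Qed.

Let s1 := Num.min s0 (v 1).

Let s1_gt0 : 0 < s1. Proof. by rewrite lt_min s0_gt0 u_side. Qed.

Let Z_ode1 s : 0 < s < s1 -> let r := Rs + e * s in
  is_derive r 1 Z (Qcoef d r - Pcoef d r * Z r).
Proof.
by rewrite lt_min => /and3P[s'0 ss _]; apply: Z_ode; rewrite s'0.
Qed.

(** The sign of [Z] comes from the profile: by the intermediate value theorem each s below v 1 is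
    some v t, where [Z] equals u'^2. This is why [s1] is capped by v 1. *)
Let Z_ge0 s : 0 < s < s1 -> 0 <= Z (Rs + e * s).
Proof.
rewrite lt_min => /and3P[s'0 _ ss].
have [t t01 vt] : exists2 t, t \in `[0, 1]%R & v t = s.
  apply: IVT => //; first exact: continuous_subspaceT.
  by rewrite v0 minEle maxEle (ltW (u_side ltr01)) ltW//= ltW.
have t0 : 0 < t.
  rewrite lt0r; move: t01; rewrite in_itv/= => /andP[-> _]; rewrite andbT.
  by apply: contraTneq s'0 => tE; rewrite -vt tE v0 ltxx.
by rewrite -vt -uE -u_ode// sqr_ge0.
Qed.

Lemma profile_side_slope_large (A : R) : exists2 t1, 0 < t1 &
  forall t, 0 < t < t1 -> A <= `|u^`() (xs + e * t)|.
Proof.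
have /cvgryPge := one_sided_solution_cvgy Hsa e1 s1_gt0 Z_ode1 Z_ge0.
move=> /(_ (A ^+ 2)) [s2 /= s20 H].
have [t1 t10 Ht1] := v_small s20; exists t1 => // t tt1.
have /andP[vt0 vt2] := Ht1 _ tt1; have /andP[t0 _] := tt1.
have /= := H (v t); rewrite sub0r normrN gtr0_norm// => /(_ vt2 vt0).
rewrite -uE -u_ode// -(real_normK (num_real A)) -(real_normK (num_real (u^`() _))).
by rewrite ler_sqr ?nnegrE// => /(le_trans (ler_norm A)).
Qed.

(** The bound on [Z] holds near [Rs] only. Away from the crossing u'^2 has a maximum [B] by
    compactness, while |u - Rs|^-b >= rho^-b with rho = R_+ - R_-; hence the additional constant |B|
    rho^b. *)
Lemma profile_side_slope_le (b M : R) : 0 < b -> a <= b ->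
  exists2 K, 0 <= K & forall t, 0 < t <= M ->
    u^`() (xs + e * t) ^+ 2 <= K * `|u (xs + e * t) - Rs| `^ (- b).
Proof.
move=> b0 ab.
have [K [s2 [K0 s20 HK]]] :=
  one_sided_solution_le Hsa e1 s1_gt0 Z_ode1 Z_ge0 b0 ab.
have [t1 t10 Ht1] := v_small s20.
have [B HB] : exists B : R, forall t, t1 / 2 <= t <= M ->
    u^`() (xs + e * t) ^+ 2 <= B.
  pose g t := u^`() (xs + e * t) ^+ 2.
  have cg : {within `[t1 / 2, M], continuous g}.
    apply: continuous_in_subspaceT => t.
    rewrite inE/= in_itv/= => /andP[tt _].
    have t0 : 0 < t by apply: lt_le_trans tt; rewrite divr_gt0.
    apply: (@continuous_comp _ _ _ (fun t => u^`() (xs + e * t))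
      (fun x => x ^+ 2)); last exact: exprn_continuous.
    apply: (@continuous_comp _ _ _ (fun t => xs + e * t) u^`()); last exact: du_cont.
    by apply: cvgD; [|apply: cvgM]; [exact: cvg_cst|exact: cvg_cst|exact: cvg_id].
  have [tM|Mt] := leP (t1 / 2) M; last first.
    exists 0 => t /andP[h1 h2]; exfalso.
    by have := lt_le_trans Mt h1; rewrite ltNge h2.
  have [c _ Hc] := EVT_max tM cg.
  by exists (g c) => t tt; apply: Hc; rewrite in_itv.
pose rho := Rplus d - Rminus d.
have B0 := normr_ge0 B.
exists (K + `|B| * rho `^ b); first by rewrite addr_ge0// mulr_ge0// powR_ge0.
move=> t /andP[t0 tM]; have vt0 : 0 < v t by exact: u_side.
rewrite vE (gtr0_norm vt0) mulrDl.
have [tt1|t1t] := ltP t t1.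
  apply: ler_wpDr; first by rewrite !mulr_ge0 ?powR_ge0.
  have /Ht1/andP[_ vs2] : 0 < t < t1 by rewrite t0.
  by rewrite u_ode// uE; apply: HK; rewrite vt0 ltW.
apply: ler_wpDl; first by rewrite mulr_ge0 ?powR_ge0.
have uB : u^`() (xs + e * t) ^+ 2 <= B.
  by apply: HB; rewrite tM andbT (le_trans _ t1t)// ler_pdivrMr// ler_pMr// ler1n.
apply: (le_trans uB); apply: (le_trans (ler_norm B)).
rewrite -mulrA ler_peMr// powRN ler_pdivlMr ?powR_gt0// mul1r.
have /andP[r1 r2] := u_range (xs + e * t).
have /andP[r3 r4] := u_range xs; rewrite u_xs in r3 r4.
apply: ge0_ler_powR; rewrite ?nnegrE ?(ltW b0) ?(ltW vt0)//.
  by rewrite subr_ge0 ltW// (lt_trans r3).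
by rewrite -[leLHS](gtr0_norm vt0) -vE /rho ler_norml; lra.
Qed.

End profile_side.

(** * The profile across the crossing *)

Section profile.
Context (R : realType) (d : wave_data R) (Rs : R).
Context (Zminus Zplus u : R -> R) (xs : R).
Hypothesis Hsa : standing_assumptions d Rs.
Hypothesis HZminus : canonical_minus d Rs Zminus.
Hypothesis HZplus : canonical_plus d Rs Zplus.
Hypothesis Hprofile : global_profile d Rs Zminus Zplus u xs.
Local Notation mu := (@lebesgue_measure R).
Local Notation "f ^` ()" := (derive1 f) : ring_scope.
Local Notation a := (sonic_exponent d Rs).

Lemma profile_C2 x : x != xs ->
  derivable u x 1 /\ derivable u^`() x 1.
Proof.
move=> xxs; suff [H _] : (forall i, (i < 2)%N -> derivable (derive1n i u) x 1) /\
    {for x, continuous (derive1n 2 u)} by split; [exact: H 0%N _|exact: H 1%N _].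
have [xl|xr|xE] := ltgtP x xs; last by rewrite xE eqxx in xxs.
- by apply: (gp_C2_left Hprofile); rewrite /= in_itv.
- by apply: (gp_C2_right Hprofile); rewrite /= in_itv/= xr.
Qed.

Lemma is_derive_profile x : x != xs -> is_derive x 1 u (u^`() x).
Proof. by move=> /profile_C2[h _]; rewrite derive1E; exact: derivableP. Qed.

Lemma continuous_profile_slope x : x != xs -> {for x, continuous u^`()}.
Proof.
move=> /profile_C2[_ h].
by apply: differentiable_continuous; exact/derivable1_diffP.
Qed.

Lemma profile_slope_ge0 x : x != xs -> 0 <= u^`() x.
Proof.
move=> xxs; have incr (A : set R) : {in A &, {homo u : x y / x < y}}.
  by move=> y z _ _; exact: gp_incr Hprofile _ _.
have [xl|xr|xE] := ltgtP x xs; last by rewrite xE eqxx in xxs.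
- apply: (@incr_derive1_ge0 _ u `]-oo, xs[%classic) => //.
    move=> y; rewrite interior_itv inE/= in_itv/= => yxs.
    have yn : y != xs by rewrite lt_eqF.
    exact: (profile_C2 yn).1.
  by rewrite interior_itv/= in_itv.
- apply: (@incr_derive1_ge0 _ u `]xs, +oo[%classic) => //.
    move=> y; rewrite interior_itv inE/= in_itv/= andbT => yxs.
    have yn : y != xs by rewrite gt_eqF.
    exact: (profile_C2 yn).1.
  by rewrite interior_itv/= in_itv/= andbT.
Qed.

Lemma profile_side_of e : e = 1 \/ e = -1 -> exists s0 Z, [/\ 0 < s0,
  forall s, 0 < s < s0 -> let r := Rs + e * s in
    is_derive r 1 Z (Qcoef d r - Pcoef d r * Z r),
  forall t, 0 < t -> 0 < e * (u (xs + e * t) - Rs) &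
  forall t, 0 < t -> u^`() (xs + e * t) ^+ 2 = Z (u (xs + e * t))].
Proof.
have [/andP[RmRs RsRp] _ _] := sa_sonic Hsa.
have uxs := gp_cross Hprofile; have incr := gp_incr Hprofile.
move=> [->|->].
- exists (Rplus d - Rs), Zplus; split.
  + by rewrite subr_gt0.
  + move=> s /andP[s0 ss] r; have [C1 _ ode _] := HZplus.
    have rr : Rs < r < Rplus d by rewrite /r; lra.
    have rI : `]Rs, Rplus d[%classic r by rewrite /= in_itv.
    have [/(_ 0%N isT) dZ _] := C1 r rI.
    rewrite -(ode _ rr) addrK derive1E; exact: derivableP.
  + by move=> t t0; rewrite mul1r subr_gt0 -uxs incr// mul1r ltrDl.
  + by move=> t t0; apply: (gp_ode_right Hprofile); rewrite mul1r ltrDl.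
- exists (Rs - Rminus d), Zminus; split.
  + by rewrite subr_gt0.
  + move=> s /andP[s0 ss] r; have [C1 _ ode _] := HZminus.
    have rr : Rminus d < r < Rs by rewrite /r; lra.
    have rI : `]Rminus d, Rs[%classic r by rewrite /= in_itv.
    have [/(_ 0%N isT) dZ _] := C1 r rI.
    rewrite -(ode _ rr) addrK derive1E; exact: derivableP.
  + by move=> t t0; rewrite !mulN1r oppr_gt0 subr_lt0 -uxs incr// gtrBl.
  + by move=> t t0; apply: (gp_ode_left Hprofile); rewrite mulN1r gtrBl.
Qed.

Lemma side_ne e t : e = 1 \/ e = -1 -> 0 < t -> xs + e * t != xs.
Proof.
by move=> [->|->] t0; rewrite ?mul1r ?mulN1r;
  [rewrite gt_eqF// ltrDl|rewrite lt_eqF// gtrBl].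
Qed.

Lemma side_decomp x : x != xs -> exists2 e, e = 1 \/ e = -1 &
  x = xs + e * `|x - xs| /\ 0 < `|x - xs|.
Proof.
move=> xxs; have x0 : 0 < `|x - xs| by rewrite normr_gt0 subr_eq0.
have [xl|xr|xE] := ltgtP x xs; last by rewrite xE eqxx in xxs.
- exists (-1); first by right.
  by split => //; rewrite ltr0_norm ?subr_lt0//; ring.
- exists 1; first by left.
  by split => //; rewrite gtr0_norm ?subr_gt0//; ring.
Qed.

Lemma profile_slope_large (A : R) : exists2 t1, 0 < t1 &
  forall x, x != xs -> `|x - xs| < t1 -> A <= `|u^`() x|.
Proof.
have H e : e = 1 \/ e = -1 -> exists2 t1, 0 < t1 &
    forall t, 0 < t < t1 -> A <= `|u^`() (xs + e * t)|.
  move=> /[dup] e1 /profile_side_of[s0 [Z [s00 ode us u2]]].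
  exact: (profile_side_slope_large Hsa e1 s00 ode (gp_cont Hprofile)
    (gp_cross Hprofile) us u2).
have [t1 t10 H1] := H 1 (or_introl erefl).
have [t2 t20 H2] := H (-1) (or_intror erefl).
exists (Num.min t1 t2); first by rewrite lt_min t10.
move=> x /side_decomp[e e1 [xE x0]]; rewrite lt_min => /andP[x1 x2].
by rewrite xE; case: e1 => ->; [apply: H1; rewrite x0|apply: H2; rewrite x0].
Qed.

Lemma profile_slope_le (b M : R) : 0 < b -> a <= b ->
  exists2 K, 0 <= K & forall x, x != xs -> `|x - xs| <= M ->
    u^`() x ^+ 2 <= K * `|u x - Rs| `^ (- b).
Proof.
move=> b0 ab.
have H e : e = 1 \/ e = -1 -> exists2 K, 0 <= K & forall t, 0 < t <= M ->
    u^`() (xs + e * t) ^+ 2 <= K * `|u (xs + e * t) - Rs| `^ (- b).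
  move=> /[dup] e1 /profile_side_of[s0 [Z [s00 ode us u2]]].
  apply: (profile_side_slope_le Hsa e1 s00 ode (gp_cont Hprofile)
    (gp_cross Hprofile) (gp_range Hprofile) us u2 _ _ b0 ab).
  by move=> t t0; apply: continuous_profile_slope; exact: side_ne.
have [K1 K10 H1] := H 1 (or_introl erefl).
have [K2 K20 H2] := H (-1) (or_intror erefl).
exists (K1 + K2); first exact: addr_ge0.
move=> x /side_decomp[e e1 [xE x0]] xM; rewrite mulrDl.
have xx : 0 < `|x - xs| <= M by rewrite x0.
have pp := powR_ge0 `|u x - Rs| (- b).
case: e1 xE => -> xE.
- apply: ler_wpDr; first exact: mulr_ge0.
  by have := H1 _ xx; rewrite -xE.
- apply: ler_wpDl; first exact: mulr_ge0.
  by have := H2 _ xx; rewrite -xE.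
Qed.

Lemma profile_ne x : x != xs -> u x - Rs != 0.
Proof.
rewrite -(gp_cross Hprofile) subr_eq0; apply: contra_neq.
have incr := gp_incr Hprofile.
by move=> uE; have [/incr|/incr|//] := ltgtP x xs; rewrite uE ltxx.
Qed.

Lemma is_derive_spowR_profile (p x : R) : x != xs ->
  is_derive x 1 (fun y => spowR p (u y - Rs))
    (p * `|u x - Rs| `^ (p - 1) * u^`() x).
Proof.
move=> xxs; have hu := is_derive_profile xxs.
have h1 : is_derive x 1 (fun y => u y - Rs) (u^`() x).
  by apply: is_derive_eq; rewrite subr0.
have h2 := is_derive_spowR p (profile_ne xxs).
have [h E] := @is_derive1_comp R (spowR p) (fun y => u y - Rs) x _ _ h2 h1.
by split; [exact: h|rewrite [LHS]E].
Qed.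

Lemma continuous_spowR_profile (p : R) : 0 < p ->
  continuous (fun y => spowR p (u y - Rs)).
Proof.
move=> p0 x; apply: (@continuous_comp _ _ _ (fun y => u y - Rs) (spowR p)).
  by apply: cvgB; [exact: gp_cont Hprofile x|exact: cvg_cst].
exact: continuous_spowR.
Qed.

Lemma profile_holder (b : R) : 0 < b -> a <= b ->
  holder_near (1 + b / 2)^-1 u xs.
Proof.
move=> b0 ab; pose p := 1 + b / 2.
have p1 : 1 <= p by rewrite lerDl divr_ge0// ltW.
have p0 : 0 < p := lt_le_trans ltr01 p1.
have [K K0 HK] := @profile_slope_le b 1 b0 ab.
(* Below, [X] is |u - Rs|^(b/2) |u'|, with X^2 <= K; then X <= K + 1, whether X <= 1 or X <= X^2. *)
pose L := p * (K + 1).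
have L0 : 0 <= L by apply: mulr_ge0; [exact: ltW|exact: addr_ge0].
have slopeL z : z != xs -> `|z - xs| <= 1 ->
    `|p * `|u z - Rs| `^ (p - 1) * u^`() z| <= L.
  move=> zxs zM; have w0 := normr_ge0 (u z - Rs).
  rewrite normrM normrM (gtr0_norm p0) (ger0_norm (powR_ge0 _ _)) -mulrA.
  rewrite ler_pM2l//; set X := _ * _.
  have X0 : 0 <= X by rewrite mulr_ge0 ?powR_ge0.
  have X2 : X ^+ 2 <= K.
    rewrite /X exprMn real_normK ?num_real//.
    have -> : (`|u z - Rs| `^ (p - 1)) ^+ 2 = `|u z - Rs| `^ b.
      rewrite -powR_mulrn ?powR_ge0// -powRrM; congr (_ `^ _).
      by rewrite /p; field.
    have pw : 0 < `|u z - Rs| `^ b by rewrite powR_gt0// normr_gt0 profile_ne.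
    by have := HK z zxs zM; rewrite powRN ler_pdivlMr// mulrC.
  have [X1|X1] := leP X 1; first by rewrite (le_trans X1)// lerDr.
  apply: (@le_trans _ _ (X ^+ 2)); first by rewrite expr2 ler_peMl// ltW.
  by rewrite (le_trans X2)// lerDl.
have lipF := lipschitz_off_point (continuous_spowR_profile p0)
  (is_derive_spowR_profile p) slopeL.
exists (ball xs 1 : set R); first exact: nbhsx_ballx.
exists ((2 `^ p * L) `^ p^-1) => x y xN yN.
have xM : `|x - xs| <= 1 by rewrite distrC ltW.
have yM : `|y - xs| <= 1 by rewrite distrC ltW.
have Lxy := lipF x y xM yM.
have pL : 0 <= 2 `^ p * L by rewrite mulr_ge0 ?powR_ge0.
rewrite -powRM//.
have -> : `|u x - u y| = (`|u x - u y| `^ p) `^ p^-1.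
  by rewrite -powRrM divff ?gt_eqF// powRr1.
have pi0 : 0 <= p^-1 by rewrite invr_ge0 ltW.
apply: ge0_ler_powR; rewrite ?nnegrE ?powR_ge0//; first exact: mulr_ge0.
have -> : u x - u y = (u x - Rs) - (u y - Rs) by ring.
apply: (le_trans (distr_powR_le _ _ p1)).
by rewrite -mulrA ler_wpM2l ?powR_ge0.
Qed.

(** Only the factor (u'^2)^((r-1)/2) of u'^r is estimated; the remaining factor u' is kept so that
    the majorant is an exact derivative. *)
Lemma profile_slope_powR_le (b r M : R) : 0 < b -> a <= b -> 1 <= r ->
  exists2 C, 0 <= C & forall x, x != xs -> `|x - xs| <= M ->
    `|u^`() x| `^ r <= C * (`|u x - Rs| `^ (- (b * (r - 1) / 2)) * u^`() x).
Proof.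
move=> b0 ab r1; have [K K0 HK] := @profile_slope_le b M b0 ab.
exists (K `^ ((r - 1) / 2)); first exact: powR_ge0.
move=> x xxs xM; have g0 := profile_slope_ge0 xxs.
have r0 : 0 < r := lt_le_trans ltr01 r1.
have r10 : 0 <= (r - 1) / 2 by rewrite divr_ge0 ?subr_ge0.
rewrite (ger0_norm g0) -(mulr_powRB1 g0 r0) mulrC mulrA ler_wpM2r//.
have -> : u^`() x `^ (r - 1) = (u^`() x ^+ 2) `^ ((r - 1) / 2).
  by rewrite -powR_mulrn// -powRrM; congr (_ `^ _); field.
have -> : - (b * (r - 1) / 2) = - b * ((r - 1) / 2) by rewrite mulNr mulrA.
rewrite [_ `^ (- b * _)]powRrM -powRM ?powR_ge0//.
apply: ge0_ler_powR; rewrite ?nnegrE ?sqr_ge0//; last exact: HK.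
by rewrite mulr_ge0 ?powR_ge0.
Qed.

Lemma profile_slope_integral_lty (b r M al be : R) : 0 < b -> a <= b ->
  1 <= r -> b * (r - 1) / 2 < 1 -> al < be ->
  (forall x, al < x < be -> x != xs /\ `|x - xs| <= M) ->
  (\int[mu]_(x in `]al, be[) `|(`|u^`() x| `^ r)|%:E < +oo)%E.
Proof.
move=> b0 ab r1 g1 albe Hx; set g := b * (r - 1) / 2 in g1 *.
have [C C0 HC] := @profile_slope_powR_le b r M b0 ab r1.
have q0 : 0 < 1 - g by rewrite subr_gt0.
(* A primitive of the majorant [f], continuous up to [xs] because 1 - g > 0; [xs] may be an end
   point of the interval. *)
pose F x := C / (1 - g) * spowR (1 - g) (u x - Rs).
pose f x := C * (`|u x - Rs| `^ (- g) * u^`() x).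
have cF : continuous F.
  move=> x; apply: cvgM; first exact: cvg_cst.
  exact: continuous_spowR_profile.
have dF x : al < x < be -> is_derive x 1 F (f x).
  move=> /Hx[xxs _]; have h1 := is_derive_spowR_profile (1 - g) xxs.
  have E : C / (1 - g) * ((1 - g) * `|u x - Rs| `^ (1 - g - 1) * u^`() x) = f x.
    rewrite /f addrAC subrr add0r; move: (_ `^ _) (u^`() x) => y z.
    by field; rewrite gt_eqF.
  by rewrite -E; exact: is_deriveZ.
have cf x : al < x < be -> {for x, continuous f}.
  move=> /Hx[xxs _]; apply: cvgM; first exact: cvg_cst.
  apply: cvgM; last exact: continuous_profile_slope.
  have n0 : 0 < `|u x - Rs| by rewrite normr_gt0 profile_ne.
  apply: (@continuous_comp _ _ _ (fun y => `|u y - Rs|) (@powR R ^~ (- g))).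
    apply: cvg_norm; apply: cvgB; last exact: cvg_cst.
    exact: gp_cont Hprofile x.
  have [dp _] := @is_derive1_powR R (- g) _ n0.
  by apply: differentiable_continuous; exact/derivable1_diffP.
have f0 x : al < x < be -> 0 <= f x.
  move=> /Hx[xxs _]; rewrite !mulr_ge0 ?powR_ge0//; exact: profile_slope_ge0.
have le1 := ge0_integral_derive_le albe cF dF cf f0.
apply: le_lt_trans (le_lt_trans le1 (ltry _)).
have mg : measurable_fun setT u^`() := measurable_off_point continuous_profile_slope.
apply: ge0_le_integral => //.
- apply/measurable_EFinP; apply: (@measurable_funS _ _ _ _ setT) => //.
  apply: measurableT_comp => //.
  apply: (@measurableT_comp _ _ _ _ _ _ (@powR R ^~ r)); first exact: measurable_powR.
  exact: measurableT_comp.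
- apply/measurable_EFinP; apply: open_continuous_measurable_fun => // x.
  by rewrite inE/= in_itv/= => /cf.
- move=> x /=; rewrite in_itv/= => /Hx[xxs xM].
  by rewrite lee_fin ger0_norm ?powR_ge0//; exact: HC.
Qed.

Lemma profile_slope_Lr_loc (b r : R) : 0 < b -> a <= b ->
  1 <= r -> b * (r - 1) / 2 < 1 -> Lr_loc r u^`().
Proof.
move=> b0 ab r1 g1.
have mg : measurable_fun setT u^`() := measurable_off_point continuous_profile_slope.
split => //; apply: (@locally_integrable_off_point _ _ xs).
- apply: (@measurableT_comp _ _ _ _ _ _ (@powR R ^~ r)); first exact: measurable_powR.
  exact: measurableT_comp.
- move=> M M0; apply: (@profile_slope_integral_lty b r M) => //; first lra.
  move=> x /andP[x1 x2]; rewrite lt_eqF//; split => //.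
  by rewrite ler_norml; lra.
- move=> M M0; apply: (@profile_slope_integral_lty b r M) => //; first lra.
  move=> x /andP[x1 x2]; rewrite gt_eqF//; split => //.
  by rewrite ler_norml; lra.
Qed.

Lemma profile_W1r_loc (b r : R) : 0 < b -> a <= b ->
  1 <= r -> b * (r - 1) / 2 < 1 -> W1r_loc r u.
Proof.
move=> b0 ab r1 g1; split.
  by apply: Lr_loc_continuous; [exact: lt_le_trans r1|exact: gp_cont Hprofile].
exists u^`(); first exact: (@profile_slope_Lr_loc b).
apply: (@weak_derivative_off_point _ _ _ xs).
- exact: gp_cont Hprofile.
- exact: is_derive_profile.
- exact: continuous_profile_slope.
(* Local integrability of the slope is the case r = 1, where the condition on the exponents reads 0
   < 1. *)
have [] := @profile_slope_Lr_loc b 1 b0 ab (lexx 1) _.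
  by rewrite subrr mulr0 mul0r.
move=> mg [_ _ lg]; split => //; first exact: openT.
move=> K KT cK; have := lg K KT cK; congr (_ < _)%E.
by apply: eq_integral => x _; rewrite powRr1// normr_id.
Qed.

Lemma profile_slope_cvgy_left : `|u^`() x| @[x --> xs^'-] --> +oo.
Proof.
apply/cvgryPge => A; have [t1 t10 H] := profile_slope_large A.
near=> x; have xx : x < xs by [].
apply: H; first by rewrite lt_eqF.
rewrite ltr0_norm ?subr_lt0// opprB ltrBlDl -ltrBlDr.
by near: x; apply: nbhs_left_gt; rewrite gtrBl.
Unshelve. all: by end_near. Qed.

Lemma profile_slope_cvgy_right : `|u^`() x| @[x --> xs^'+] --> +oo.
Proof.
apply/cvgryPge => A; have [t1 t10 H] := profile_slope_large A.
near=> x; have xx : xs < x by [].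
apply: H; first by rewrite gt_eqF.
rewrite gtr0_norm ?subr_gt0// ltrBlDl.
by near: x; apply: nbhs_right_lt; rewrite ltrDl.
Unshelve. all: by end_near. Qed.

Lemma profile_not_lipschitz : ~ lipschitz_near u xs.
Proof.
move=> [N Nxs [L [_ HL]]].
(* Every number above [L] is a Lipschitz constant on [N], in particular |L| + 1; a secant from [xs]
   equals some slope u'(z), of modulus at least |L| + 2. *)
have [t1 t10 H] := profile_slope_large (`|L| + 2).
move: (Nxs); rewrite -nbhs_ballE => -[dl dl0 HN].
have m0 : 0 < Num.min t1 dl by rewrite lt_min t10.
have m1 : Num.min t1 dl <= t1 by rewrite ge_min lexx.
have m2 : Num.min t1 dl <= dl by rewrite ge_min lexx orbT.
move: (Num.min t1 dl) m0 m1 m2 => mm m0 m1 m2; pose y := xs + mm / 2.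
have xy : xs < y by rewrite /y ltrDl divr_gt0.
have Ny : N y.
  by apply: HN; rewrite /ball/= /y ltr_norml; lra.
have cw : {within `[xs, y], continuous u}.
  by apply: continuous_subspaceT; exact: gp_cont Hprofile.
have du z : z \in `]xs, y[%R -> is_derive z 1 u (u^`() z).
  by rewrite in_itv/= => /andP[xz _]; apply: is_derive_profile; rewrite gt_eqF.
have [z + uE] := MVT xy du cw; rewrite in_itv/= => /andP[xz zy].
have gz : `|L| + 2 <= `|u^`() z|.
  apply: H; first by rewrite gt_eqF.
  by rewrite gtr0_norm ?subr_gt0//; move: zy; rewrite /y; lra.
have LL : L < `|L| + 1 by rewrite (le_lt_trans (ler_norm _))// ltrDl.
have := HL _ LL (y, xs) (conj Ny (nbhs_singleton Nxs)) => /=.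
rewrite uE normrM ler_pM2r ?normr_gt0 ?subr_eq0 ?gt_eqF//.
move=> /(le_trans gz); lra.
Qed.

End profile.

Theorem proposition4p6 (R : realType) (d : wave_data R) (Rs : R)
    (Zminus Zplus : R -> R) (u : R -> R) (xs : R)
    (Hstanding : standing_assumptions d Rs)
    (HZminus : canonical_minus d Rs Zminus)
    (HZplus : canonical_plus d Rs Zplus)
    (Hprofile : global_profile d Rs Zminus Zplus u xs) :
  let a := sonic_exponent d Rs in
  [/\ 0 < a < 2 ->
        let b := (1 + a / 2)^-1 in
        [/\ 2^-1 < b < 1,
            holder_near b u xs,
            forall r : R, 1 <= r < 1 + 2 / a -> W1r_loc r u,
            `|u^`() x| @[x --> xs^'-] --> +oo &
            `|u^`() x| @[x --> xs^'+] --> +oo],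
      a = 0 ->
        [/\ forall b : R, 0 < b < 1 -> holder_near b u xs,
            forall r : R, 1 <= r -> W1r_loc r u,
            `|u^`() x| @[x --> xs^'-] --> +oo &
            `|u^`() x| @[x --> xs^'+] --> +oo] &
      ~ lipschitz_near u xs].
Proof.
move=> a.
have cvgl := profile_slope_cvgy_left Hstanding HZminus HZplus Hprofile.
have cvgr := profile_slope_cvgy_right Hstanding HZminus HZplus Hprofile.
have holder := profile_holder Hstanding HZminus HZplus Hprofile.
have w1r := profile_W1r_loc Hstanding HZminus HZplus Hprofile.
split; last exact: profile_not_lipschitz Hstanding HZminus HZplus Hprofile.
- move=> /andP[a0 a2] b; split => //.
  + rewrite /b; apply/andP; split; last by rewrite invf_lt1; lra.
    by rewrite ltf_pV2 ?posrE; lra.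
  + exact: holder.
  + move=> r /andP[r1 ra]; apply: (w1r a) => //.
    rewrite ltr_pdivrMr// mul1r mulrC -ltr_pdivlMr//; lra.
- move=> a0; split => //.
  + move=> b /andP[b0 b1].
    have bi : 1 < b^-1 by rewrite invf_gt1.
    (* Solves (1 + b'/2)^-1 = b for the growth exponent b', which is positive because b < 1. *)
    have -> : b = (1 + (2 * (b^-1 - 1)) / 2)^-1.
      by rewrite mulrAC divff// mul1r subrKC invrK.
    by apply: holder; rewrite -/a ?a0; lra.
  + move=> r r1; have r0 : 0 < r by apply: lt_le_trans r1.
    (* The growth exponent 1/r is admissible, as (1/r) (r - 1) / 2 < 1/2. *)
    apply: (w1r r^-1) => //; rewrite -/a ?a0 ?invr_gt0 ?invr_ge0 ?(ltW r0)//.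
    rewrite ltr_pdivrMr// mul1r mulrC ltr_pdivrMr//; lra.
Qed.
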